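(* Let $\alpha:\mathscr{F}\to\mathscr{F}'$ be a homomorphism of frames, $\mathscr{F}=(S,I,R,\sigma,\sigma_1)$, $\mathscr{F}'=(S',I',R',\sigma',\sigma_1')$, inducing an isomorphism $R\cong R'$ and a surjection $S\to S'$ with kernel $\mathfrak{a}$. Assume there is a finite filtration $\mathfrak{a}=\mathfrak{a}_0\supseteq\cdots\supseteq\mathfrak{a}_n=0$ with $\sigma(\mathfrak{a}_i)\subseteq\mathfrak{a}_{i+1}$ and $\sigma_1(\mathfrak{a}_i)\subseteq\mathfrak{a}_i$, and that finitely generated projective $S'$-modules lift to projective $S$-modules. Let $J\subset S$ be an ideal of definition for $\mathscr{F}$ with $J^m\mathfrak{a}=0$ for large $m$. Then $\alpha$ is nil-crystalline with respect to $J\subset S$ and $J'=J/\mathfrak{a}\subset S'$.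
   Context: A frame is $(S,I,R,\sigma,\sigma_1)$ with $R=S/I$, $\sigma$ a ring endomorphism of $S$, $\sigma_1:I\to S$ $\sigma$-linear, $I+pS\subseteq\mathrm{Rad}(S)$, $\sigma(a)\equiv a^p\bmod pS$, and $\sigma_1(I)$ generating $S$; $\theta\in S$ is the unique element with $\sigma(a)=\theta\sigma_1(a)$ for $a\in I$. A window is $(P,Q,F,F_1)$ with $P$ f.g. projective, $Q\subseteq P$, $F:P\to P$, $F_1:Q\to P$ $\sigma$-linear, $P=L\oplus T$ with $Q=L\oplus IT$, $F_1(ax)=\sigma_1(a)F(x)$ for $a\in I$, $F_1(Q)$ generating $P$. A homomorphism of frames is a ring map $\alpha:S\to S'$ with $\alpha(I)\subseteq I'$, $\sigma'\alpha=\alpha\sigma$, $\sigma_1'\alpha=u\,\alpha\sigma_1$ for a unit $u\in S'$; base change $\alpha_*$ of windows is characterised by $\mathrm{Hom}(\alpha_*\mathscr{P},\mathscr{P}')=\{g:P\to P'\mid g(Q)\subseteq Q',F'g=gF,F_1'g=u\,gF_1\}$. For a window $\mathscr{P}$, $V^\sharp:P\to P^{(\sigma)}=S\otimes_{\sigma,S}P$ is the unique $S$-linear map with $V^\sharp(F_1(x))=1\otimes x$ for $x\in Q$, and $(V^\sharp)^n:P\to P^{(\sigma^n)}$ denotes the iterated composite. An ideal of definition of $\mathscr{F}$ is an ideal $J\subseteq S$ with $\sigma(J)+I+\theta S\subseteq J$. A window is nilpotent with respect to $J$ if $(V^\sharp)^n\equiv0$ modulo $J$ for $n$ large. For ideals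 of definition $J\subset S$, $J'\subset S'$ with $\alpha(J)\subseteq J'$, $\alpha$ is nil-crystalline if $\alpha_*$ induces an equivalence between nilpotent $\mathscr{F}$-windows and nilpotent $\mathscr{F}'$-windows. *)

(* Defs.v *)
From Stdlib Require List.
From HB Require Import structures.
From mathcomp Require Import all_boot all_order all_algebra.
Set Implicit Arguments. Unset Strict Implicit. Unset Printing Implicit Defensive.
Import GRing.Theory.
Local Open Scope ring_scope.

Section Defs.

Definition is_ideal (S : comUnitRingType) (I : S -> Prop) : Prop :=
  I 0 /\ (forall x y, I x -> I y -> I (x + y)) /\ (forall s x, I x -> I (s * x)).

Definition is_maximal_ideal (S : comUnitRingType) (M : S -> Prop) : Prop :=
  is_ideal M /\ ~ M 1 /\
  (forall K : S -> Prop, is_ideal K -> ~ K 1 -> (forall x, M x -> K x) ->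
     forall x, K x -> M x).

Definition in_jacobson (S : comUnitRingType) (x : S) : Prop :=
  forall M : S -> Prop, is_maximal_ideal M -> M x.

Definition semilinear (S T : comUnitRingType) (beta : S -> T)
  (M : lmodType S) (N : lmodType T) (f : M -> N) : Prop :=
  (forall x y, f (x + y) = f x + f y) /\ (forall a x, f (a *: x) = beta a *: f x).

Definition S_linear (S : comUnitRingType) (M N : lmodType S) (f : M -> N) : Prop :=
  semilinear (fun a : S => a) f.

Definition is_submod (S : comUnitRingType) (M : lmodType S) (L : M -> Prop) : Prop :=
  L 0 /\ (forall x y, L x -> L y -> L (x + y)) /\ (forall a x, L x -> L (a *: x)).

Definition in_span (S : comUnitRingType) (M : lmodType S) (G : M -> Prop) (x : M) : Prop :=
  exists s : seq (S * M), List.Forall (fun q => G q.2) s /\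
                          x = \sum_(q <- s) q.1 *: q.2.

Definition ideal_times (S : comUnitRingType) (J : S -> Prop) (M : lmodType S) (x : M) : Prop :=
  in_span (fun y : M => exists a m, J a /\ y = a *: m) x.

Definition finitely_generated (S : comUnitRingType) (M : lmodType S) : Prop :=
  exists gens : seq M, forall x, in_span (fun y => List.In y gens) x.

Definition projective (S : comUnitRingType) (P : lmodType S) : Prop :=
  forall (M N : lmodType S) (pi : M -> N) (f : P -> N),
    S_linear pi -> (forall y, exists x, pi x = y) -> S_linear f ->
    exists g : P -> M, S_linear g /\ forall x, pi (g x) = f x.

Definition fg_projective (S : comUnitRingType) (P : lmodType S) : Prop :=
  finitely_generated P /\ projective P.

Definition is_mod_base_change (S T : comUnitRingType) (beta : S -> T)
  (M : lmodType S) (N : lmodType T) (iota : M -> N) : Prop :=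
  semilinear beta iota /\
  forall (X : lmodType T) (phi : M -> X), semilinear beta phi ->
    exists psi : N -> X, S_linear psi /\ (forall x, psi (iota x) = phi x) /\
      forall psi' : N -> X, S_linear psi' -> (forall x, psi' (iota x) = phi x) ->
        forall y, psi' y = psi y.

Record frame (S : comUnitRingType) := Frame {
  fI : S -> Prop;
  fsigma : {rmorphism S -> S};
  fsigma1 : S -> S }.

Definition is_frame (p : nat) (S : comUnitRingType) (F : frame S) : Prop :=
  let I := fI F in let sigma := fsigma F in let sigma1 := fsigma1 F in
  is_ideal I /\
  (forall x y, I x -> in_jacobson (x + p%:R * y)) /\
  (forall a, exists b, sigma a = a ^+ p + p%:R * b) /\
  (forall x y, I x -> I y -> sigma1 (x + y) = sigma1 x + sigma1 y) /\
  (forall s x, I x -> sigma1 (s * x) = sigma s * sigma1 x) /\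
  (forall s : S, exists l : seq (S * S),
      List.Forall (fun q => I q.2) l /\ s = \sum_(q <- l) q.1 * sigma1 q.2).

(* theta is the unique element with sigma(a) = theta sigma1(a) for a in I *)
Definition is_theta (S : comUnitRingType) (F : frame S) (theta : S) : Prop :=
  forall a, fI F a -> fsigma F a = theta * fsigma1 F a.

Definition is_ideal_of_definition (S : comUnitRingType) (F : frame S) (J : S -> Prop) : Prop :=
  is_ideal J /\ (forall x, J x -> J (fsigma F x)) /\ (forall x, fI F x -> J x) /\
  (forall theta, is_theta F theta -> J theta).

Definition is_frame_hom (S S' : comUnitRingType) (F : frame S) (F' : frame S')
  (alpha : {rmorphism S -> S'}) (u : S') : Prop :=
  u \is a GRing.unit /\
  (forall x, fI F x -> fI F' (alpha x)) /\
  (forall x, fsigma F' (alpha x) = alpha (fsigma F x)) /\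
  (forall x, fI F x -> fsigma1 F' (alpha x) = u * alpha (fsigma1 F x)).

Record window (S : comUnitRingType) := Window {
  wP :> lmodType S;
  wQ : wP -> Prop;
  wF : wP -> wP;
  wF1 : wP -> wP }.   (* only the values of wF1 on wQ matter *)
Arguments wP {S} w.
Arguments wQ {S} w _.
Arguments wF {S} w _.
Arguments wF1 {S} w _.

Definition is_window (S : comUnitRingType) (F : frame S) (W : window S) : Prop :=
  let I := fI F in let sigma := fsigma F in let sigma1 := fsigma1 F in
  fg_projective (wP W) /\ is_submod (wQ W) /\
  semilinear sigma (wF W) /\
  (forall x y, wQ W x -> wQ W y -> wF1 W (x + y) = wF1 W x + wF1 W y) /\
  (forall a x, wQ W x -> wF1 W (a *: x) = sigma a *: wF1 W x) /\
  (exists L T : W -> Prop, is_submod L /\ is_submod T /\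
     (forall x, exists l t, L l /\ T t /\ x = l + t) /\
     (forall x, L x -> T x -> x = 0) /\
     (forall x, wQ W x <-> exists l t, L l /\
          in_span (fun y => exists a t0, I a /\ T t0 /\ y = a *: t0) t /\ x = l + t)) /\
  (forall a x, I a -> wF1 W (a *: x) = sigma1 a *: wF W x) /\
  (forall x, in_span (fun y => exists q, wQ W q /\ y = wF1 W q) x).

Definition window_hom (S : comUnitRingType) (W1 W2 : window S) (g : W1 -> W2) : Prop :=
  S_linear g /\ (forall x, wQ W1 x -> wQ W2 (g x)) /\
  (forall x, wF W2 (g x) = g (wF W1 x)) /\
  (forall x, wQ W1 x -> wF1 W2 (g x) = g (wF1 W1 x)).

Definition alpha_hom (S S' : comUnitRingType) (alpha : {rmorphism S -> S'}) (u : S')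
  (W : window S) (W' : window S') (g : W -> W') : Prop :=
  semilinear alpha g /\ (forall x, wQ W x -> wQ W' (g x)) /\
  (forall x, wF W' (g x) = g (wF W x)) /\
  (forall x, wQ W x -> wF1 W' (g x) = u *: g (wF1 W x)).

Definition is_window_base_change (S S' : comUnitRingType) (F' : frame S')
  (alpha : {rmorphism S -> S'}) (u : S') (W : window S) (W' : window S') (eta : W -> W') : Prop :=
  is_window F' W' /\ alpha_hom alpha u eta /\
  forall (W'' : window S') (g : W -> W''), is_window F' W'' -> alpha_hom alpha u g ->
    exists h : W' -> W'', window_hom h /\ (forall x, h (eta x) = g x) /\
      forall h' : W' -> W'', window_hom h' -> (forall x, h' (eta x) = g x) ->
        forall y, h' y = h y.

(* composite (V^#)^(k+1) : P -> P^(sigma^(k+1)) = N k *)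
Fixpoint vsharp_iter (S : comUnitRingType) (P : Type) (N : nat -> lmodType S)
  (v0 : P -> N 0) (vS : forall k, N k -> N k.+1) (k : nat) : P -> N k :=
  match k return P -> N k with
  | 0 => v0
  | k'.+1 => fun x => vS k' (vsharp_iter v0 vS k' x)
  end.

(* N k plays the role of P^(sigma^(k+1)), iota0 : P -> P^(sigma), iotaS k : N k -> N k.+1
   the universal sigma-linear maps; v0 = V^#; vS k = (V^#)^(sigma^(k+1)). *)
Definition nilpotent_window (S : comUnitRingType) (F : frame S) (J : S -> Prop)
  (W : window S) : Prop :=
  exists (N : nat -> lmodType S) (iota0 : W -> N 0) (iotaS : forall k, N k -> N k.+1)
         (v0 : W -> N 0) (vS : forall k, N k -> N k.+1),
    is_mod_base_change (fsigma F) iota0 /\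
    (forall k, is_mod_base_change (fsigma F) (iotaS k)) /\
    S_linear v0 /\ (forall x, wQ W x -> v0 (wF1 W x) = iota0 x) /\
    (forall k, S_linear (vS k)) /\
    (forall x, vS 0 (iota0 x) = iotaS 0 (v0 x)) /\
    (forall k y, vS k.+1 (iotaS k y) = iotaS k.+1 (vS k y)) /\
    exists n, forall x, ideal_times J (vsharp_iter v0 vS n x).

Definition nil_crystalline (S S' : comUnitRingType) (F : frame S) (F' : frame S')
  (alpha : {rmorphism S -> S'}) (u : S') (J : S -> Prop) (J' : S' -> Prop) : Prop :=
  (forall (W : window S) (W' : window S') (eta : W -> W'),
     is_window F W -> nilpotent_window F J W ->
     is_window_base_change F' alpha u eta -> nilpotent_window F' J' W') /\
  (forall (W1 W2 : window S) (W2' : window S') (eta2 : W2 -> W2'),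
     is_window F W1 -> nilpotent_window F J W1 ->
     is_window F W2 -> nilpotent_window F J W2 ->
     is_window_base_change F' alpha u eta2 ->
     (forall g : W1 -> W2', alpha_hom alpha u g ->
        exists f : W1 -> W2, window_hom f /\ forall x, eta2 (f x) = g x) /\
     (forall f f' : W1 -> W2, window_hom f -> window_hom f' ->
        (forall x, eta2 (f x) = eta2 (f' x)) -> forall x, f x = f' x)) /\
  (forall W' : window S', is_window F' W' -> nilpotent_window F' J' W' ->
     exists (W : window S) (eta : W -> W'),
       is_window F W /\ nilpotent_window F J W /\ is_window_base_change F' alpha u eta).

End Defs.

(* Main.v *)
(** The kernel [a] of [alpha] satisfies [a <= I <= J], so [a] is a nilpotent ideal, and
    base change along [alpha] is reduction modulo [a].  Let [Psi] be the sum of [F1] on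
    [L] and [F] on [T].  For every window its linearisation from [L^(sigma) + T^(sigma)]
    to [P] is not only onto but bijective: the rank of a finitely generated projective
    module is recorded by idempotents of [S], and these are fixed by [sigma] because
    [sigma] is the Frobenius modulo [p] and [p] lies in the radical.

    Essential surjectivity: idempotent matrices lift along [alpha], hence so do [L] and
    [T]; lifting [Psi] arbitrarily gives a window by Nakayama, and [V^#] modulo [J] is
    unchanged.

    Full faithfulness: given a linear lift of a homomorphism, correcting it by a map [w]
    with values in [a P] amounts to solving [w = h + U w], where [U w] is the composite
    of [V^#] with the linearisation of [F1 \o w].  The iterate [U^k w] factors through
    the [k]-th iterate of [V^#], so nilpotence gives values in [J^m a P = 0] for
    large [k]; thus [1 - U] is invertible.

    All of this is done in coordinates: [P] is described by a finite dual basis with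
    Gram matrix [E], the twist [P^(sigma)] is the module of row vectors fixed by
    [sigma(E)], and the iterates of [V^#] are the twisted powers
    [C sigma(C) sigma^2(C) ...] of its matrix [C]. *)

From Pilot Require Import Defs.
From Stdlib Require List.
From HB Require Import structures.
From mathcomp Require Import all_boot all_order all_algebra.
From mathcomp Require Import ring boolp classical_sets.
Import GRing.Theory.
Local Open Scope ring_scope.

Set Implicit Arguments. Unset Strict Implicit. Unset Printing Implicit Defensive.

Local Notation semilinear := Pilot.Defs.semilinear.

Local Arguments wQ {S} w _.
Local Arguments wF {S} w _.
Local Arguments wF1 {S} w _.

(** * Idempotents and ranks *)

Section JacobsonRadical.
Variable S : comUnitRingType.

Lemma proper_ideal_in_maximal (K : S -> Prop) : is_ideal K -> ~ K 1 ->
  exists M, is_maximal_ideal M /\ forall x, K x -> M x.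
Proof.
move=> idK K1.
(* Zorn's lemma also ranges over the empty chain, whose union is empty; adjoining [K] to [A] makes
   the predicate hold there. *)
pose P (A : S -> Prop) := is_ideal (fun x => A x \/ K x) /\ ~ (A 1 \/ K 1).
have [|A [[idA A1] maxA]] := @Zorn_bigcup S P.
  move=> C CP tot.
  have [K0 [KD KM]] := idK.
  pose U : S -> Prop := (\bigcup_(X in C) X)%classic.
  have UM s x : U x \/ K x -> U (s * x) \/ K (s * x).
    case=> [[X CX Xx]|Kx]; last by right; apply: KM.
    have [[_ [_ XM]] _] := CP X CX.
    by case: (XM s x (or_introl Xx)) => [h|]; [left; exists X | right].
  have UD x y : U x \/ K x -> U y \/ K y -> U (x + y) \/ K (x + y).
    have inX (X : S -> Prop) : C X -> X x \/ K x -> X y \/ K y ->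
        U (x + y) \/ K (x + y).
      move=> CX hx hy; have [[_ [XD _]] _] := CP X CX.
      by case: (XD x y hx hy) => h; [left; exists X | right].
    case=> [[X CX Xx]|Kx]; case=> [[Y CY Yy]|Ky].
    - have [XY|YX] := tot X Y CX CY.
      + by apply: (inX Y) => //; left => //; apply: XY.
      + by apply: (inX X) => //; left => //; apply: YX.
    - by apply: (inX X) => //; [left|right].
    - by apply: (inX Y) => //; [right|left].
    - by right; apply: KD.
  split; first by split; [right | split].
  case=> [[X CX X1]|//].
  by have [_ []] := CP X CX; left.
exists (fun x => A x \/ K x); split; last by move=> x; right.
split=> //; split=> // N idN N1 AN x Nx.
have AsubN : (A `<=` N)%classic by move=> y Ay; apply: AN; left.
case: (pselect (A x)) => Ax; first by left.
exfalso; apply: (maxA N); first by split=> // /(_ x Nx).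
split; last by case.
suff -> : (fun x => N x \/ K x) = N by [].
apply/funext => y; apply/propext; split=> [[//|Ky]|]; last by left.
by apply: AN; right.
Qed.

(** A nonunit [1 - x] lies in some maximal ideal; that ideal contains [x] as well, hence 1. *)
Lemma unit_1B_jacobson (x : S) : in_jacobson x -> 1 - x \is a GRing.unit.
Proof.
move=> radx; case: (boolP (1 - x \is a GRing.unit)) => // nu; exfalso.
have [|[s s1]|M [maxM KM]] :=
  @proper_ideal_in_maximal (fun y => exists s, y = s * (1 - x)).
- split; first by exists 0; rewrite mul0r.
  split=> [y z [s ->] [t ->]|s y [t ->]]; first by exists (s + t); rewrite mulrDl.
  by exists (s * t); rewrite mulrA.
- by move/negP: nu; apply; apply/unitrPr; exists s; rewrite mulrC -s1.
have Mx := radx M maxM; have [[M0 [MD MM]] [M1 _]] := maxM.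
apply: M1; rewrite -(subrK x 1); apply: MD => //.
by apply: KM; exists 1; rewrite mul1r.
Qed.

(** Idempotents satisfy (c - d)^3 = c - d, so c - d is killed by the unit 1 - (c - d)^2. *)
Lemma idempotent_eq_mod_jacobson (c d : S) : c * c = c -> d * d = d ->
  in_jacobson ((c - d) * (c - d)) -> c = d.
Proof.
move=> cc dd /unit_1B_jacobson; set y := 1 - _ => uy.
apply/eqP; rewrite -subr_eq0; apply/eqP.
apply: (mulIr uy); rewrite mul0r /y mulrBr mulr1.
have -> : (c - d) * ((c - d) * (c - d)) =
    c * c * c - (c * c * d) *+ 3 + (c * (d * d)) *+ 3 - d * d * d by ring.
by rewrite !cc !dd; ring.
Qed.

(** Since [c ^+ p = c], the Frobenius congruence puts [sigma c - c] in pS, hence in the radical. *)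
Lemma frame_sigma_idempotent (p : nat) (F : frame S) (c : S) :
  (0 < p)%N -> is_frame p F -> c * c = c -> fsigma F c = c.
Proof.
move=> p0 [[I0 _] [rad [frob _]]] cc.
have cp : c ^+ p = c.
  by case: p p0 {rad frob} => // p _; elim: p => [|p IH]; rewrite ?expr1 // exprS IH.
have [b sc] := frob c; rewrite cp in sc.
apply: idempotent_eq_mod_jacobson => //; first by rewrite -rmorphM cc.
rewrite {1}sc (addrC c) addrK -mulrA -[X in in_jacobson X]add0r.
exact: rad.
Qed.

End JacobsonRadical.

(** Sylvester's identity: one block matrix has two block triangular factorisations, whose
    determinants are compared. *)
Lemma det_1DmulC (R : comNzRingType) (n : nat) (A B : 'M[R]_n) :
  \det (1%:M + A *m B) = \det (1%:M + B *m A).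
Proof.
have e1 : block_mx 1%:M A 0 1%:M *m block_mx (1%:M + A *m B) 0 (- B) 1%:M
       = block_mx 1%:M A (- B) 1%:M.
  by rewrite mulmx_block !(mul1mx, mulmx1, mul0mx, mulmx0, addr0, add0r) mulmxN
             addrK.
have e2 : block_mx 1%:M 0 (- B) 1%:M *m block_mx 1%:M A 0 (1%:M + B *m A)
       = block_mx 1%:M A (- B) 1%:M.
  by rewrite mulmx_block !(mul1mx, mulmx1, mul0mx, mulmx0, addr0, add0r) mulNmx
             addrC addrK.
have := congr1 determinant (etrans e1 (esym e2)).
by rewrite !det_mulmx !det_ublock !det_lblock !det1 !mul1r !mulr1.
Qed.

(** * Ranks of idempotent matrices via their rank polynomials *)

Section RankPolynomial.
Variables (S : comNzRingType) (r : nat).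
Implicit Type E : 'M[S]_r.

(* The coefficient of 'X^i is the idempotent cutting out the locus where the
   image of [E] has rank [i]. *)
Definition rank_poly E : {poly S} :=
  \det (1%:M + ('X - 1) *: map_mx polyC E).

(** Allowing [t] in another ring makes it possible to substitute independent variables as well as
    constants. *)
Lemma rank_poly_eval (R : comNzRingType) (f : {rmorphism S -> R}) (t : R) E :
  (map_poly f (rank_poly E)).[t] = \det (1%:M + (t - 1) *: map_mx f E).
Proof.
rewrite /rank_poly -det_map_mx -[LHS]/(horner_eval t _) -det_map_mx.
congr determinant; apply/matrixP=> i j; rewrite !mxE /=.
rewrite /horner_eval rmorphD rmorphMn rmorph1 rmorphM rmorphB rmorph1 /=.
by rewrite map_polyX map_polyC /= !hornerE hornerMn hornerE.
Qed.

(** The matrix 1 + (t - 1) E acts as t on the image of E and as 1 on its kernel, so it is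
    multiplicative in t. *)
Lemma mul_1DB_idem (R : comNzRingType) (E : 'M[R]_r) (s t : R) : E *m E = E ->
  (1%:M + (s - 1) *: E) *m (1%:M + (t - 1) *: E) = 1%:M + (s * t - 1) *: E.
Proof.
move=> EE; rewrite mulmxDl mul1mx mulmxDr mulmx1 -scalemxAl -scalemxAr EE -addrA.
by congr (_ + _); rewrite scalerA -!scalerDl; congr (_ *: _); ring.
Qed.

(** With c(t) = det (1 + (t - 1) E) and independent s and t, represented by ['X%:P] and ['X], one
    has c(s) c(t) = c(st); the coefficient of s^i t^i gives the claim. *)
Lemma rank_poly_idem E i : E *m E = E ->
  (rank_poly E)`_i * (rank_poly E)`_i = (rank_poly E)`_i.
Proof.
move=> EE; pose f : {rmorphism S -> {poly {poly S}}} := polyC \o polyC.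
have fEE : map_mx f E *m map_mx f E = map_mx f E by rewrite -map_mxM EE.
have := congr1 determinant (mul_1DB_idem ('X%:P) 'X fEE).
rewrite det_mulmx -!rank_poly_eval.
set c := rank_poly E.
have -> : map_poly f c = map_poly polyC (map_poly polyC c).
  by rewrite -map_poly_comp.
move/(congr1 (fun q : {poly {poly S}} => q`_i`_i)).
have -> : (map_poly polyC (map_poly polyC c)).['X%:P] = c%:P.
  by rewrite horner_map /=; congr polyC; rewrite -/(comp_poly 'X c) comp_polyXr.
have -> : (map_poly polyC (map_poly polyC c)).['X] = map_poly polyC c.
  by rewrite -/(comp_poly 'X _) comp_polyXr.
rewrite coefCM coef_map /= coefMC => ->.
rewrite -/(comp_poly _ _).
have -> : ('X%:P * 'X : {poly {poly S}}) = 'X *: 'X by rewrite mul_polyC.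
rewrite comp_polyE coef_sum.
have [ltic|leci] := ltnP i (size (map_poly polyC c)).
  rewrite (bigD1 (Ordinal ltic)) //= big1 ?addr0 => [|j neji].
    by rewrite exprZn !coefZ coefXn eqxx mulr1 coef_map /= coefCM coefXn eqxx mulr1.
  rewrite exprZn !coefZ coefXn; case: eqP => [ij|]; last by rewrite !mulr0.
  by case/eqP: neji; apply: val_inj.
rewrite big1 => [|j _].
  by rewrite coef0 nth_default // -(size_map_polyC c).
rewrite exprZn !coefZ coefXn; case: eqP => [ij|]; last by rewrite !mulr0.
by move: (ltn_ord j); rewrite -ij ltnNge leci.
Qed.

(** Multiplying 1 + (X - 1) E by X + (1 - X) E gives the scalar matrix X, so the rank polynomial
    divides ['X^r] and is a nonzerodivisor. *)
Lemma rank_poly_lreg E (q : {poly S}) : E *m E = E ->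
  rank_poly E = rank_poly E * q -> q = 1.
Proof.
move=> EE; set D := map_mx polyC E.
have DD : D *m D = D by rewrite -map_mxM EE.
move/(congr1 ( *%R (\det ('X *: 1%:M + (1 - 'X) *: D)))).
rewrite mulrA -!det_mulmx.
have -> : ('X *: 1%:M + (1 - 'X) *: D) *m (1%:M + ('X - 1) *: D) = 'X%:M.
  rewrite mulmxDr mulmx1 !mulmxDl -!scalemxAl -!scalemxAr mul1mx DD.
  rewrite -addrA scalemx1 -[RHS]addr0; congr (_ + _).
  by rewrite !scalerA -!scalerDl -[RHS](scale0r D); congr (_ *: _); ring.
rewrite det_scalar -{1}['X^r]mulr1 => eqX; apply/polyP=> i.
by have := congr1 (fun q : {poly S} => q`_(r + i)) eqX; rewrite !coefXnM ltnNge leq_addr addKn.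
Qed.

Lemma rank_poly_map (f : {rmorphism S -> S}) E :
  rank_poly (map_mx f E) = map_poly f (rank_poly E).
Proof.
rewrite /rank_poly -det_map_mx; congr determinant; apply/matrixP=> i j.
by rewrite !mxE rmorphD rmorphMn rmorph1 rmorphM rmorphB rmorph1 /= map_polyX map_polyC.
Qed.

Lemma rank_poly_orthogonal (D K : 'M[S]_r) : D *m K = 0 ->
  rank_poly (D + K) = rank_poly D * rank_poly K.
Proof.
move=> DK; rewrite /rank_poly -det_mulmx; congr determinant.
rewrite mulmxDl mul1mx mulmxDr mulmx1 -scalemxAl -scalemxAr -map_mxM DK map_mx0.
by rewrite !scaler0 addr0 map_mxD scalerDr addrA addrAC.
Qed.

(* A surjection from the [f]-twist of the image of [E] onto the image of [E] is
   bijective: both have the same rank polynomial, so the kernel has rank 0. *)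
Lemma split_twist_inverse (f : {rmorphism S -> S}) (E B G : 'M[S]_r) :
  (forall c, c * c = c -> f c = c) -> E *m E = E ->
  G *m B = E -> B *m E = B -> map_mx f E *m B = B -> G *m map_mx f E = G ->
  B *m G = map_mx f E.
Proof.
move=> fidem EE GB BE fEB GfE; set fE := map_mx f E in fEB GfE *.
have fEE : fE *m fE = fE by rewrite -map_mxM EE.
have BGBG : B *m G *m (B *m G) = B *m G by rewrite mulmxA -(mulmxA B) GB BE.
(* [K] projects onto the kernel of v |-> v B on the image of [fE]. *)
pose K := fE - B *m G.
have BGK : B *m G *m K = 0 by rewrite mulmxBr BGBG -mulmxA GfE subrr.
have KK : K *m K = K.
  by rewrite {1}/K mulmxBl BGK subr0 mulmxBr fEE mulmxA fEB.
have rpBG : rank_poly (B *m G) = rank_poly E.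
  by rewrite /rank_poly map_mxM scalemxAl det_1DmulC -scalemxAr -map_mxM GB.
have rpE : rank_poly fE = rank_poly E.
  rewrite rank_poly_map; apply/polyP=> i; rewrite coef_map /=.
  by apply: fidem; apply: rank_poly_idem.
have rpK : rank_poly K = 1.
  apply: (rank_poly_lreg EE); rewrite -{1}rpE -rpBG -rank_poly_orthogonal //.
  by rewrite /K addrC subrK.
(* Evaluation at 0 gives det (1 - K) = 1, so 1 - K is invertible, while (1 - K) K = 0. *)
have K0 : K = 0.
  have := rank_poly_eval idfun 0 K; rewrite map_poly_id // rpK hornerC.
  rewrite map_mx_id // sub0r scaleN1r => /esym det1K.
  have : \adj (1%:M - K) *m ((1%:M - K) *m K) = 0.
    by rewrite mulmxBl mul1mx KK subrr mulmx0.
  by rewrite mulmxA mul_adj_mx det1K mul1mx.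
by apply/eqP; rewrite eq_sym -subr_eq0 -/K K0.
Qed.

End RankPolynomial.

(** * Modules with a finite dual basis *)

Section Semilinear.
Variables (S T : comUnitRingType) (beta : S -> T) (M : lmodType S) (N : lmodType T).
Implicit Type f : M -> N.

Lemma semilinear0 f : semilinear beta f -> f 0 = 0.
Proof. by case=> fD _; apply: (@addrI _ (f 0)); rewrite -fD !addr0. Qed.

Lemma semilinearN f x : semilinear beta f -> f (- x) = - f x.
Proof.
move=> lf; apply: (@addrI _ (f x)).
by rewrite -(proj1 lf) !subrr (semilinear0 lf).
Qed.

Lemma semilinearB f x y : semilinear beta f -> f (x - y) = f x - f y.
Proof. by move=> lf; rewrite (proj1 lf) (semilinearN _ lf). Qed.

Lemma semilinear_sum f (I : Type) (s : seq I) (c : I -> S) (x : I -> M) :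
  semilinear beta f ->
  f (\sum_(i <- s) c i *: x i) = \sum_(i <- s) beta (c i) *: f (x i).
Proof.
move=> lf; elim: s => [|i s IH]; first by rewrite !big_nil (semilinear0 lf).
by rewrite !big_cons (proj1 lf) (proj2 lf) IH.
Qed.

End Semilinear.

Section Submodules.
Variables (S : comUnitRingType) (M : lmodType S).
Implicit Types (G K : M -> Prop) (x y : M).

Lemma submodN K x : is_submod K -> K x -> K (- x).
Proof. by case=> _ [_ KZ] Kx; rewrite -scaleN1r; apply: KZ. Qed.

Lemma submodB K x y : is_submod K -> K x -> K y -> K (x - y).
Proof. by move=> sK Kx Ky; apply: (proj1 (proj2 sK)) => //; apply: submodN. Qed.

Lemma submod_sum K (I : Type) (s : seq I) (c : I -> S) (x : I -> M) :
  is_submod K -> (forall i, K (c i *: x i)) -> K (\sum_(i <- s) c i *: x i).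
Proof.
case=> K0 [KD _] Kx; elim: s => [|i s IH]; rewrite ?big_nil ?big_cons //.
exact: KD.
Qed.

Lemma in_span_submod G : is_submod (in_span G).
Proof.
split; first by exists [::]; rewrite big_nil; split=> //; constructor.
split=> [x y [s [Gs ->]] [t [Gt ->]]|c x [s [Gs ->]]].
  by exists (s ++ t); rewrite big_cat; split=> //; apply/List.Forall_app.
exists [seq (c * q.1, q.2) | q <- s]; split.
  by elim: Gs => [|q s' Gq _ IH]; constructor.
by rewrite big_map scaler_sumr; apply: eq_bigr => q _; rewrite scalerA.
Qed.

Lemma mem_in_span G x : G x -> in_span G x.
Proof.
move=> Gx; exists [:: (1, x)]; rewrite big_seq1 scale1r; split=> //.
by constructor.
Qed.

Lemma in_span0 G : in_span G 0.
Proof. by case: (in_span_submod G). Qed.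

Lemma in_spanZ G c x : in_span G x -> in_span G (c *: x).
Proof. by apply (proj2 (proj2 (in_span_submod G))). Qed.

Lemma in_spanD G x y : in_span G x -> in_span G y -> in_span G (x + y).
Proof. by apply (proj1 (proj2 (in_span_submod G))). Qed.

(** This serves as the induction principle for spans, with [K] the property to be proved. *)
Lemma in_span_min G K : is_submod K -> (forall x, G x -> K x) ->
  forall x, in_span G x -> K x.
Proof.
move=> [K0 [KD KZ]] GK x [s [Gs ->]]; elim: Gs => [|q s' Gq _ IH].
  by rewrite big_nil.
by rewrite big_cons; apply: KD => //; apply: KZ; apply: GK.
Qed.

Lemma ideal_times_submod J : is_submod (@ideal_times S J M).
Proof. exact: in_span_submod. Qed.

Lemma mem_ideal_times (J : S -> Prop) c x : J c -> ideal_times J (c *: x).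
Proof. by move=> Jc; apply: mem_in_span; exists c, x. Qed.

Lemma in_span_linear_eq (N : lmodType S) (f g : M -> N) G :
  S_linear f -> S_linear g -> (forall x, in_span G x) ->
  (forall x, G x -> f x = g x) -> forall x, f x = g x.
Proof.
move=> lf lg spG fg x; apply: (in_span_min _ fg (spG x)).
split; first by rewrite (semilinear0 lf) (semilinear0 lg).
split=> [y z fy fz|c y fy]; first by rewrite (proj1 lf) (proj1 lg) fy fz.
by rewrite (proj2 lf) (proj2 lg) fy.
Qed.

(* Descending induction on the number of factors from the nilpotent ideal [A]. *)
Lemma nilpotent_nakayama (A : S -> Prop) (m : nat) K :
  (forall js, size js = m -> List.Forall A js -> \prod_(j <- js) j = 0) ->
  is_submod K -> (forall x, exists y, K y /\ ideal_times A (x - y)) ->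
  forall x, K x.
Proof.
move=> nilA sK KA x; have [K0 [KD KZ]] := sK.
suff PK k js y : (k <= m)%N -> size js = (m - k)%N -> List.Forall A js ->
    K (\prod_(j <- js) j *: y).
  by have := PK m [::] x (leqnn m); rewrite subnn big_nil scale1r; apply=> //; constructor.
elim: k js y => [|k IH] js y lekm szjs Ajs.
  by rewrite nilA ?scale0r //; rewrite szjs subn0.
have [z [Kz]] := KA y; move: (y - z) (subrK z y) => w <- Aw.
rewrite scalerDr; apply: (KD); last exact: KZ.
apply: (in_span_min (K := fun w => K (\prod_(j <- js) j *: w)) _ _ Aw).
  split; first by rewrite scaler0.
  split=> [v v' Kv Kv'|c v Kv]; first by rewrite scalerDr; apply: KD.
  by rewrite scalerA mulrC -scalerA; apply: KZ.
move=> _ [c [v [Ac ->]]]; have := IH (c :: js) v (ltnW lekm).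
rewrite big_cons scalerA mulrC; apply; last by constructor.
by rewrite /= szjs -subSn // subSS.
Qed.

End Submodules.

Section LinearCombinations.
Variables (S : comUnitRingType) (M : lmodType S).

Definition lincomb r (v : 'rV[S]_r) (e : 'I_r -> M) : M := \sum_i v 0 i *: e i.

Lemma lincomb_linear r (e : 'I_r -> M) : S_linear (fun v => lincomb v e).
Proof.
split=> [v w|c v]; rewrite /lincomb.
  by rewrite -big_split /=; apply: eq_bigr => i _; rewrite mxE scalerDl.
by rewrite scaler_sumr; apply: eq_bigr => i _; rewrite mxE scalerA.
Qed.

Lemma lincomb_mulmx r q (v : 'rV[S]_r) (A : 'M[S]_(r, q)) (e : 'I_q -> M) :
  lincomb (v *m A) e = lincomb v (fun i => lincomb (row i A) e).
Proof.
rewrite /lincomb; under eq_bigr => j _ do rewrite mxE scaler_suml.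
rewrite exchange_big /=; apply: eq_bigr => i _.
by rewrite scaler_sumr; apply: eq_bigr => j _; rewrite scalerA mxE.
Qed.

Lemma semilinear_lincomb (T : comUnitRingType) (beta : S -> T) (N : lmodType T)
    (f : M -> N) r (v : 'rV[S]_r) (e : 'I_r -> M) :
  semilinear beta f -> f (lincomb v e) = \sum_i beta (v 0 i) *: f (e i).
Proof. exact: semilinear_sum. Qed.

Lemma eq_lincomb r (v : 'rV[S]_r) (e e' : 'I_r -> M) :
  e =1 e' -> lincomb v e = lincomb v e'.
Proof. by move=> ee'; apply: eq_bigr => i _; rewrite ee'. Qed.

Lemma lincomb_submod (K : M -> Prop) r (v : 'rV[S]_r) (e : 'I_r -> M) :
  is_submod K -> (forall i, K (v 0 i *: e i)) -> K (lincomb v e).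
Proof. exact: submod_sum. Qed.

End LinearCombinations.

Lemma linear_lincomb (S : comUnitRingType) (M N : lmodType S)
    (f : M -> N) r (v : 'rV[S]_r) (e : 'I_r -> M) :
  S_linear f -> f (lincomb v e) = lincomb v (f \o e).
Proof. exact: semilinear_lincomb. Qed.

Lemma lincomb_rows (S : comUnitRingType) r q (v : 'rV[S]_r) (A : 'M[S]_(r, q)) :
  lincomb v (fun i => row i A) = v *m A.
Proof. by rewrite mulmx_sum_row. Qed.

Lemma lincomb_map_mx (S T : comUnitRingType) (beta : S -> T) (N : lmodType T) r
    (v : 'rV[S]_r) (e : 'I_r -> N) :
  lincomb (map_mx beta v) e = \sum_i beta (v 0 i) *: e i.
Proof. by apply: eq_bigr => i _; rewrite mxE. Qed.

Lemma List_InP (T : eqType) (x : T) (s : seq T) : reflect (List.In x s) (x \in s).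
Proof.
elim: s => [|y s IH] /=; first by constructor.
rewrite inE eq_sym; apply: (iffP orP) => [[/eqP|/IH]|[->|/IH]]; by [left|right|left].
Qed.

(** * Dual bases and their idempotent Gram matrices *)

Section DualBasis.
Variables (S : comUnitRingType) (P : lmodType S) (r : nat).
Variables (e : 'I_r -> P) (phi : P -> 'rV[S]_r).

(** The components of [phi] are the functionals of the dual basis; equivalently, [phi] splits the
    surjection from row vectors onto [P] given by [e]. *)
Definition dual_basis : Prop :=
  S_linear phi /\ forall x, x = lincomb (phi x) e.

(** An idempotent with row space [phi P], so [P] is identified with the row vectors it fixes. *)
Definition gram : 'M[S]_r := \matrix_(i < r) phi (e i).

Hypothesis db : dual_basis.

Lemma dual_basis_mul_gram x : phi x *m gram = phi x.
Proof.
rewrite {2}(proj2 db x) (linear_lincomb _ _ (proj1 db)) -lincomb_rows.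
by apply: eq_lincomb => i; rewrite rowK.
Qed.

Lemma gram_idem : gram *m gram = gram.
Proof. by apply/row_matrixP => i; rewrite row_mul rowK dual_basis_mul_gram. Qed.

Lemma dual_basis_semilinear (T : comUnitRingType) (beta : S -> T) (N : lmodType T)
    (f : P -> N) x :
  semilinear beta f -> f x = lincomb (map_mx beta (phi x)) (f \o e).
Proof.
by move=> lf; rewrite {1}(proj2 db x) (semilinear_lincomb _ _ lf) lincomb_map_mx.
Qed.

Lemma dual_basis_fg_projective : fg_projective P.
Proof.
split.
  exists [seq e i | i <- enum 'I_r] => x; rewrite (proj2 db x).
  apply: (lincomb_submod (in_span_submod _)).
  move=> i; apply: in_spanZ; apply: mem_in_span.
  by apply/List_InP; apply: map_f; rewrite mem_enum.
move=> M N pi f lpi spi lf.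
have spi' y : exists x, pi x == y by have [x <-] := spi y; exists x.
exists (fun x => lincomb (phi x) (fun i => xchoose (spi' (f (e i))))); split.
  have [lD lZ] := proj1 db.
  split=> *; first by rewrite lD (proj1 (lincomb_linear _)).
  by rewrite lZ (proj2 (lincomb_linear _)).
move=> x; rewrite (linear_lincomb _ _ lpi) {2}(proj2 db x) (linear_lincomb _ _ lf).
by apply: eq_lincomb => i /=; apply: (eqP (xchooseP (spi' (f (e i))))).
Qed.

(* Any [iota] whose target has the dual basis [iota \o e] with compatible
   coordinates is a base change; no tensor product is needed. *)
Lemma dual_basis_base_change (T : comUnitRingType) (beta : {rmorphism S -> T})
    (N : lmodType T) (iota : P -> N) (phi' : N -> 'rV[T]_r) :
  semilinear beta iota -> S_linear phi' ->
  (forall y, y = lincomb (phi' y) (iota \o e)) ->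
  (forall x, phi' (iota x) = map_mx beta (phi x)) ->
  is_mod_base_change beta iota.
Proof.
move=> li lphi' expand' phi'i; split=> // X f lf.
exists (fun y => lincomb (phi' y) (f \o e)); split.
  split=> *; first by rewrite (proj1 lphi') (proj1 (lincomb_linear _)).
  by rewrite (proj2 lphi') (proj2 (lincomb_linear _)).
split=> [x|g lg gi y]; first by rewrite phi'i -dual_basis_semilinear.
rewrite {1}(expand' y) (linear_lincomb _ _ lg).
by apply: eq_lincomb => i; apply: gi.
Qed.

End DualBasis.

(** Projectivity splits the surjection from the free module on a finite generating list. *)
Lemma fg_projective_dual_basis (S : comUnitRingType) (P : lmodType S) :
  fg_projective P -> exists r (e : 'I_r -> P) phi, dual_basis e phi.
Proof.
case=> -[gens genP] projP; pose e (i : 'I_(size gens)) := tnth (in_tuple gens) i.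
have lpi := lincomb_linear e.
have [||phi [lphi phiK]] := projP _ _ (fun v => lincomb v e) id lpi.
- move=> y; apply: (in_span_min (K := fun y => exists v, lincomb v e = y) _ _ (genP y)).
    split; first by exists 0; rewrite (semilinear0 lpi).
    split=> [_ _ [v <-] [w <-]|c _ [v <-]]; first by exists (v + w); rewrite (proj1 lpi).
    by exists (c *: v); rewrite (proj2 lpi).
  move=> x /List_InP.
  case/(tnthP (in_tuple gens)) => i ->; exists (delta_mx 0 i).
  rewrite /lincomb (bigD1 i) //= mxE !eqxx scale1r big1 ?addr0 // => j neji.
  by rewrite mxE (negPf neji) andbF scale0r.
- by split.
by exists _, e, phi; split=> // x; rewrite phiK.
Qed.

Lemma base_change_ext (S T : comUnitRingType) (beta : S -> T)
    (M : lmodType S) (N : lmodType T) (iota : M -> N) (X : lmodType T) (f g : N -> X) :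
  is_mod_base_change beta iota -> S_linear f -> S_linear g ->
  (forall x, f (iota x) = g (iota x)) -> forall y, f y = g y.
Proof.
case=> li univ lf lg fg y.
have [|h [_ [_ uniq]]] := univ X (fun x => f (iota x)).
  by split=> *; rewrite ?(proj1 li) ?(proj2 li) ?(proj1 lf) ?(proj2 lf).
by rewrite (uniq f) // (uniq g).
Qed.

(** * The image of an idempotent matrix as a projective module *)

Section FixedVectors.
Variables (S : comUnitRingType) (r : nat) (E : 'M[S]_r).

Definition fixed_pred : {pred 'rV[S]_r} := fun v => v *m E == v.

Lemma fixed_submod_closed : submod_closed fixed_pred.
Proof.
split=> [|c v w]; rewrite !unfold_in ?mul0mx // => /eqP vE /eqP wE.
by rewrite mulmxDl -scalemxAl vE wE.
Qed.

HB.instance Definition _ :=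
  GRing.isSubmodClosed.Build S 'rV[S]_r fixed_pred fixed_submod_closed.

(** For idempotent [E] this is the image of [E]; such modules serve as concrete twists P^(sigma^k),
    reductions and lifts. *)
Record fixmod := Fixmod { fixval :> 'rV[S]_r; fixvalP : fixval \in fixed_pred }.

HB.instance Definition _ := [isSub for fixval].
HB.instance Definition _ := [Choice of fixmod by <:].
HB.instance Definition _ := [SubChoice_isSubLmodule of fixmod by <:].

Lemma fixmod_eq (v : fixmod) : v *m E = v.
Proof. exact: eqP (fixvalP v). Qed.

Lemma fixmod_inj (v w : fixmod) : fixval v = fixval w -> v = w.
Proof. exact: val_inj. Qed.

Lemma fixval_linear : S_linear (fixval : fixmod -> 'rV[S]_r).
Proof. by split. Qed.

Hypothesis EE : E *m E = E.

Lemma fix_proj_subproof v : v *m E \in fixed_pred.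
Proof. by rewrite unfold_in -mulmxA EE. Qed.

Definition fix_proj v : fixmod := Fixmod (fix_proj_subproof v).

Definition fix_row i : fixmod := fix_proj (row i 1%:M).

Lemma fix_row_val i : fixval (fix_row i) = row i E.
Proof. by rewrite /= -row_mul mul1mx. Qed.

Lemma fixmod_dual_basis : dual_basis fix_row fixval.
Proof.
split=> [|v]; first exact: fixval_linear.
apply: fixmod_inj; rewrite (linear_lincomb _ _ fixval_linear) -[LHS]fixmod_eq.
by rewrite -lincomb_rows; apply: eq_lincomb => i; rewrite /= -row_mul mul1mx.
Qed.

Lemma fixmod_fg_projective : fg_projective fixmod.
Proof. exact: dual_basis_fg_projective fixmod_dual_basis. Qed.

End FixedVectors.

(** * Windows and the bijectivity of [Psi] *)

Section Windows.
Variables (p : nat) (S : comUnitRingType) (F : frame S).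
Hypotheses (p_gt0 : (0 < p)%N) (hF : is_frame p F).
Local Notation I := (fI F).
Local Notation sigma := (fsigma F).
Local Notation sigma1 := (fsigma1 F).

Lemma frame_sigma1D x y : I x -> I y -> sigma1 (x + y) = sigma1 x + sigma1 y.
Proof. by case: hF => _ [_ [_ [h _]]]; apply: h. Qed.

Lemma frame_sigma1M s x : I x -> sigma1 (s * x) = sigma s * sigma1 x.
Proof. by case: hF => _ [_ [_ [_ [h _]]]]; apply: h. Qed.

Lemma frame_ideal : is_ideal I. Proof. by case: hF. Qed.

(** Writing 1 as a combination of values sigma1(b) with b in I, theta is the same combination of the
    sigma(b), because sigma(c) sigma1(b) = sigma1(cb) = sigma(b) sigma1(c). *)
Lemma frame_theta : exists theta, is_theta F theta.
Proof.
have [_ [_ [_ [_ [_ gen]]]]] := hF; have [l [Il l1]] := gen 1.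
exists (\sum_(q <- l) q.1 * sigma q.2) => c Ic.
rewrite -[LHS]mulr1 l1 mulr_sumr mulr_suml.
elim: Il {l1} => [|q l' Iq _ IH]; first by rewrite !big_nil.
rewrite !big_cons IH; congr (_ + _).
by rewrite mulrCA -!mulrA -!frame_sigma1M // (mulrC c).
Qed.

(* [pi] is the projection onto [T] along [L] of a normal decomposition. *)
Definition normal_projection (W : window S) (pi : W -> W) : Prop :=
  S_linear pi /\ (forall x, pi (pi x) = pi x) /\
  forall x, wQ W x <-> ideal_times I (pi x).

Section OneWindow.
Variable W : window S.
Hypothesis hW : is_window F W.
Local Notation Q := (wQ W).
Local Notation F1 := (wF1 W).

Lemma window_fg_projective : fg_projective W. Proof. by case: hW. Qed.

Lemma window_Q_submod : is_submod Q. Proof. by case: hW => _ []. Qed.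

Lemma window_F_semilinear : semilinear sigma (wF W).
Proof. by case: hW => _ [_ []]. Qed.

Lemma window_F1D x y : Q x -> Q y -> F1 (x + y) = F1 x + F1 y.
Proof. by case: hW => _ [_ [_ [h _]]]; apply: h. Qed.

Lemma window_F1Z c x : Q x -> F1 (c *: x) = sigma c *: F1 x.
Proof. by case: hW => _ [_ [_ [_ [h _]]]]; apply: h. Qed.

Lemma window_F1_I c x : I c -> F1 (c *: x) = sigma1 c *: wF W x.
Proof. by case: hW => _ [_ [_ [_ [_ [_ [h _]]]]]]; apply: h. Qed.

Lemma window_F1_span x : in_span (fun y => exists q, Q q /\ y = F1 q) x.
Proof. by case: hW => _ [_ [_ [_ [_ [_ [_ h]]]]]]. Qed.

Lemma window_F1_0 : F1 0 = 0.
Proof.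
by rewrite -(scale0r 0) window_F1Z ?rmorph0 ?scale0r //; case: window_Q_submod.
Qed.

Lemma window_F1B x y : Q x -> Q y -> F1 (x - y) = F1 x - F1 y.
Proof.
move=> Qx Qy; rewrite window_F1D //; last exact: (submodN window_Q_submod).
by rewrite -scaleN1r window_F1Z // rmorphN1 scaleN1r.
Qed.

Lemma window_F1_sum (X : Type) (s : seq X) (c : X -> S) (x : X -> W) :
  (forall i, Q (x i)) ->
  F1 (\sum_(i <- s) c i *: x i) = \sum_(i <- s) sigma (c i) *: F1 (x i).
Proof.
move=> Qx; have QZ i : Q (c i *: x i) by apply: (proj2 (proj2 window_Q_submod)).
elim: s => [|i s IH]; first by rewrite !big_nil window_F1_0.
rewrite !big_cons window_F1D ?IH ?window_F1Z //.
exact: (submod_sum s window_Q_submod).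
Qed.

Lemma window_normal_projection : exists pi : W -> W, normal_projection pi.
Proof.
have [_ [_ [_ [_ [_ [[L [T [sL [sT [LTsum [LT0 QE]]]]]] _]]]]]] := hW.
have /choice[pi piP] : forall x, exists t, T t /\ L (x - t).
  by move=> x; have [l [t [Ll [Tt ->]]]] := LTsum x; exists t; rewrite addrK.
have piE x t : T t -> L (x - t) -> pi x = t.
  move=> Tt Lxt; have [Tp Lp] := piP x; apply/eqP; rewrite -subr_eq0; apply/eqP.
  apply: LT0; last exact: (submodB sT).
  have -> : pi x - t = (x - t) - (x - pi x) by rewrite opprB [RHS]addrC subrKA.
  exact: (submodB sL).
have [_ [LD LZ]] := sL; have [T0 [TD TZ]] := sT.
have lpi : S_linear pi.
  split=> [x y|c x]; apply: piE.
  - by apply: TD; [case: (piP x) | case: (piP y)].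
  - by rewrite opprD addrACA; apply: LD; [case: (piP x) | case: (piP y)].
  - by apply: TZ; case: (piP x).
  - by rewrite -scalerBr; apply: LZ; case: (piP x).
exists pi; split=> //; split=> x.
  by apply: piE; [case: (piP x) | rewrite subrr; case: sL].
rewrite QE; split=> [[l [t [Ll [It ->]]]]|Ipi].
  have Tt : T t by apply: (in_span_min sT _ It) => _ [c [t0 [_ [Tt0 ->]]]]; apply: TZ.
  rewrite (@piE _ t) ?addrK //; apply: (in_span_min _ _ It); first exact: in_span_submod.
  by move=> _ [c [t0 [Ic [_ ->]]]]; apply: mem_ideal_times.
exists (x - pi x), (pi x); split; first by case: (piP x).
split; last by rewrite subrK.
(* A second application of [pi] moves the vectors in an expression of [pi x] over [I] into [T]. *)
have -> : pi x = pi (pi x).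
  by apply/esym/piE; [case: (piP x) | rewrite subrr; case: sL].
apply: (in_span_min (K := fun y => in_span _ (pi y)) _ _ Ipi).
  split; first by rewrite (semilinear0 lpi); apply: in_span0.
  split=> *; rewrite ?(proj1 lpi) ?(proj2 lpi); [exact: in_spanD | exact: in_spanZ].
move=> _ [c [y [Ic ->]]]; rewrite (proj2 lpi); apply: mem_in_span.
by exists c, (pi y); split=> //; split=> //; case: (piP y).
Qed.

Lemma window_IQ c x : I c -> Q (c *: x).
Proof.
have [pi [lpi [_ QE]]] := window_normal_projection.
by move=> Ic; apply/QE; rewrite (proj2 lpi); apply: mem_ideal_times.
Qed.

(** [F] is determined by [F1], because sigma1(I) generates the unit ideal. *)
Lemma window_F_of_F1 (l : seq (S * S)) x :
  List.Forall (fun q => I q.2) l -> 1 = \sum_(q <- l) q.1 * sigma1 q.2 ->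
  wF W x = \sum_(q <- l) q.1 *: F1 (q.2 *: x).
Proof.
move=> Il l1; rewrite -[LHS]scale1r l1 scaler_suml.
elim: Il {l1} => [|q l' Iq _ IH]; first by rewrite !big_nil.
by rewrite !big_cons IH window_F1_I // scalerA.
Qed.

Lemma window_F_theta theta x : is_theta F theta -> Q x -> wF W x = theta *: F1 x.
Proof.
move=> thetaE Qx; have [_ [_ [_ [_ [_ gen]]]]] := hF; have [l [Il l1]] := gen 1.
rewrite (window_F_of_F1 x Il l1) -[theta]mulr1 l1 mulr_sumr scaler_suml.
elim: Il {l1} => [|q l' Iq _ IH]; first by rewrite !big_nil.
by rewrite !big_cons IH window_F1Z // scalerA thetaE // mulrCA.
Qed.

Lemma window_F1_sum_I (X : Type) (s : seq X) (c : X -> S) (x : X -> W) :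
  (forall i, I (c i)) ->
  F1 (\sum_(i <- s) c i *: x i) = \sum_(i <- s) sigma1 (c i) *: wF W (x i).
Proof.
move=> Ic; have QZ i : Q (c i *: x i) by apply: window_IQ.
elim: s => [|i s IH]; first by rewrite !big_nil window_F1_0.
rewrite !big_cons window_F1D ?IH ?window_F1_I //.
exact: (submod_sum s window_Q_submod).
Qed.

End OneWindow.

Lemma normal_projection_decomposition (W : window S) (pi : W -> W) :
  normal_projection pi ->
  exists L T : W -> Prop, is_submod L /\ is_submod T /\
     (forall x, exists l t, L l /\ T t /\ x = l + t) /\
     (forall x, L x -> T x -> x = 0) /\
     (forall x, wQ W x <-> exists l t, L l /\
          in_span (fun y => exists a t0, I a /\ T t0 /\ y = a *: t0) t /\ x = l + t).
Proof.
move=> [lpi [pipi QE]]; have pi0 := semilinear0 lpi.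
exists (fun x => pi x = 0), (fun x => pi x = x).
split; first by split=> //; split=> [x y|c x];
  rewrite ?(proj1 lpi) ?(proj2 lpi) => ->; rewrite ?scaler0 // => ->; rewrite addr0.
have sT : is_submod (fun x => pi x = x).
  by split=> //; split=> [x y|c x]; rewrite ?(proj1 lpi) ?(proj2 lpi) => -> // ->.
split=> //; split.
  move=> x; exists (x - pi x), (pi x); split; last by split; rewrite ?subrK.
  by rewrite (semilinearB _ _ lpi) pipi subrr.
split=> [x -> //|x]; rewrite QE; split=> [Ix|[l [t [l0 [It ->]]]]].
  exists (x - pi x), (pi x); split; first by rewrite (semilinearB _ _ lpi) pipi subrr.
  split; last by rewrite subrK.
  rewrite -pipi; apply: (in_span_min (K := fun y => in_span _ (pi y)) _ _ Ix).
    split; first by rewrite pi0; apply: in_span0.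
    split=> *; rewrite ?(proj1 lpi) ?(proj2 lpi); [exact: in_spanD | exact: in_spanZ].
  by move=> _ [c [y [Ic ->]]]; rewrite (proj2 lpi); apply: mem_in_span; exists c, (pi y).
have Tt : pi t = t.
  by apply: (in_span_min sT _ It) => _ [c [t0 [_ [Tt0 ->]]]]; rewrite (proj2 lpi) Tt0.
rewrite (proj1 lpi) l0 add0r Tt; apply: (in_span_min (in_span_submod _) _ It).
by move=> _ [c [t0 [Ic [_ ->]]]]; apply: mem_ideal_times.
Qed.

(** The linearisation of [Theta] is onto, and by the rank comparison it is bijective, so [psi]
    factors through it. [B] is its matrix and [G] collects coordinates of preimages of the
    generators. *)
Lemma spanning_semilinear_extend (P X : lmodType S) (Theta : P -> P) (psi : P -> X) :
  fg_projective P -> semilinear sigma Theta ->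
  (forall y, in_span (fun z => exists x, z = Theta x) y) ->
  semilinear sigma psi ->
  exists eta : P -> X, S_linear eta /\ forall x, eta (Theta x) = psi x.
Proof.
move=> /fg_projective_dual_basis[r [e [phi db]]] lT spT lpsi.
have [lphi expand] := db; pose E := gram e phi.
have EE : E *m E = E := gram_idem db.
pose B := \matrix_(i < r) phi (Theta (e i)).
have phiT x : phi (Theta x) = map_mx sigma (phi x) *m B.
  rewrite (dual_basis_semilinear db _ lT) (linear_lincomb _ _ lphi) -lincomb_rows.
  by apply: eq_lincomb => i; rewrite rowK.
(* The condition that sigma(E) fixes [v] places the preimage in P^(sigma) rather than in the ambient
   free module. *)
have /choice[g gP] : forall y, exists v : 'rV[S]_r,
    v *m map_mx sigma E = v /\ phi y = v *m B.
  move=> y; apply: (in_span_min (K := fun y => exists v, _ /\ _) _ _ (spT y)).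
    split; first by exists 0; rewrite !mul0mx (semilinear0 lphi).
    split=> [y1 y2 [v [vE vB]] [w [wE wB]]|c y1 [v [vE vB]]].
      by exists (v + w); rewrite !mulmxDl vE wE (proj1 lphi) vB wB.
    by exists (c *: v); rewrite -!scalemxAl vE (proj2 lphi) vB.
  move=> _ [x ->]; exists (map_mx sigma (phi x)).
  by rewrite -map_mxM dual_basis_mul_gram.
pose G := \matrix_(i < r) g (e i).
have GB : G *m B = E.
  by apply/row_matrixP => i; rewrite row_mul !rowK; case: (gP (e i)).
have GE : G *m map_mx sigma E = G.
  by apply/row_matrixP => i; rewrite row_mul !rowK; case: (gP (e i)).
have BE : B *m E = B.
  by apply/row_matrixP => i; rewrite row_mul !rowK dual_basis_mul_gram.
have EB : map_mx sigma E *m B = B.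
  by apply/row_matrixP => i; rewrite row_mul -map_row !rowK phiT.
(* Surjectivity gave [G *m B = E]; this is injectivity. *)
have BG : B *m G = map_mx sigma E.
  apply: split_twist_inverse => // c cc.
  exact: frame_sigma_idempotent p_gt0 hF cc.
exists (fun y => lincomb (phi y *m G) (psi \o e)); split.
  split=> *; rewrite ?(proj1 lphi) ?(proj2 lphi).
    by rewrite mulmxDl (proj1 (lincomb_linear _)).
  by rewrite -scalemxAl (proj2 (lincomb_linear _)).
move=> x; rewrite phiT -mulmxA BG -map_mxM (dual_basis_mul_gram db).
by rewrite -(dual_basis_semilinear db _ lpsi).
Qed.

(* [F1 + F] is a sigma-linear bijection in the sense that [L^(sigma) + T^(sigma)]
   maps isomorphically to [P], so a compatible pair of maps factors through it. *)
Lemma window_extend (W : window S) (X : lmodType S) (g f : W -> X) :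
  is_window F W ->
  (forall x y, wQ W x -> wQ W y -> g (x + y) = g x + g y) ->
  (forall c x, wQ W x -> g (c *: x) = sigma c *: g x) ->
  semilinear sigma f ->
  (forall c x, I c -> g (c *: x) = sigma1 c *: f x) ->
  exists eta : W -> X, S_linear eta /\ forall x, wQ W x -> eta (wF1 W x) = g x.
Proof.
move=> hW gD gZ lf gI; have [pi [lpi [pipi QE]]] := window_normal_projection hW.
have lF := window_F_semilinear hW; have sQ := window_Q_submod hW.
have [Q0 [QD QZ]] := sQ.
have pi_compl x : pi (x - pi x) = 0 by rewrite (semilinearB _ _ lpi) pipi subrr.
have Qc x : wQ W (x - pi x).
  by apply/QE; rewrite pi_compl; apply: in_span0.
have cD x y : x + y - pi (x + y) = x - pi x + (y - pi y).
  by rewrite (proj1 lpi) opprD addrACA.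
have cZ c x : c *: x - pi (c *: x) = c *: (x - pi x).
  by rewrite (proj2 lpi) scalerBr.
(* The map Psi: [F1] on [L] plus [F] on [T], written on [P] by means of [pi]; [psi] combines [g] and
   [f] in the same way. *)
pose Theta x := wF1 W (x - pi x) + wF W (pi x).
pose psi x := g (x - pi x) + f (pi x).
have lT : semilinear sigma Theta.
  split=> [x y|c x]; rewrite /Theta ?cD ?cZ ?(proj1 lpi) ?(proj2 lpi).
    by rewrite (window_F1D hW) // (proj1 lF) addrACA.
  by rewrite (window_F1Z hW) // (proj2 lF) scalerDr.
have lpsi : semilinear sigma psi.
  split=> [x y|c x]; rewrite /psi ?cD ?cZ ?(proj1 lpi) ?(proj2 lpi).
    by rewrite gD // (proj1 lf) addrACA.
  by rewrite gZ // (proj2 lf) scalerDr.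
have g0 : g 0 = 0 by rewrite -(scale0r 0) gZ ?rmorph0 ?scale0r.
have TL x : Theta (x - pi x) = wF1 W (x - pi x).
  by rewrite /Theta pi_compl subr0 (semilinear0 lF) addr0.
have TT x : Theta (pi x) = wF W (pi x).
  by rewrite /Theta pipi subrr (window_F1_0 hW) add0r.
have psiL x : psi (x - pi x) = g (x - pi x).
  by rewrite /psi pi_compl subr0 (semilinear0 lf) addr0.
have psiT x : psi (pi x) = f (pi x) by rewrite /psi pipi subrr g0 add0r.
have Qpi x : wQ W x -> wQ W (pi x) by rewrite !QE pipi.
(* Induction over Q = L + IT. Membership in [Q] is carried along because [F1] and [g] are additive
   only there. *)
have Q_ind (K : W -> Prop) :
    (forall x y, wQ W x -> K x -> wQ W y -> K y -> K (x + y)) ->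
    (forall c x, wQ W x -> K x -> K (c *: x)) -> K 0 -> (forall x, K (x - pi x)) ->
    (forall c x, I c -> K (c *: pi x)) -> forall x, wQ W x -> K x.
  move=> KD KZ K0 KL KT x Qx; rewrite -(subrK (pi x) x).
  apply: (KD) => //; first exact: Qpi.
  move/QE: (Qx) => Ix; rewrite -pipi.
  suff [] : wQ W (pi (pi x)) /\ K (pi (pi x)) by [].
  apply: (in_span_min (K := fun y => wQ W (pi y) /\ K (pi y)) _ _ Ix).
    split; first by rewrite (semilinear0 lpi).
    split=> [y z [Qy Ky] [Qz Kz]|c y [Qy Ky]]; rewrite ?(proj1 lpi) ?(proj2 lpi).
      by split; [apply: QD | apply: KD].
    by split; [apply: QZ | apply: KZ].
  move=> _ [c [y [Ic ->]]]; rewrite (proj2 lpi); split; last exact: KT.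
  exact: window_IQ.
(* On IT one has F1(c t) = sigma1(c) F(t), so the values of [F1] lie in the span of [Theta]. *)
have spT y : in_span (fun z => exists x, z = Theta x) y.
  apply: (in_span_min (in_span_submod _) _ (window_F1_span hW y)) => _ [q [Qq ->]].
  apply: (Q_ind (fun q => in_span (fun z => exists x, z = Theta x) (wF1 W q))) => //.
  - by move=> x z Qx Kx Qz Kz; rewrite (window_F1D hW) //; apply: in_spanD.
  - by move=> c x Qx Kx; rewrite (window_F1Z hW) //; apply: in_spanZ.
  - by rewrite (window_F1_0 hW); apply: in_span0.
  - by move=> x; apply: mem_in_span; exists (x - pi x).
  - by move=> c x Ic; rewrite (window_F1_I hW) // -TT; apply: in_spanZ;
       apply: mem_in_span; exists (pi x).
have [eta [leta etaT]] := spanning_semilinear_extend (window_fg_projective hW) lT spT lpsi.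
exists eta; split=> //; apply: Q_ind.
- by move=> x y Qx Kx Qy Ky; rewrite (window_F1D hW) // (proj1 leta) Kx Ky gD.
- by move=> c x Qx Kx; rewrite (window_F1Z hW) // (proj2 leta) Kx gZ.
- by rewrite (window_F1_0 hW) (semilinear0 leta) g0.
- by move=> x; rewrite -TL etaT psiL.
- by move=> c x Ic; rewrite (window_F1_I hW) // (proj2 leta) -TT etaT psiT gI.
Qed.

End Windows.

(** * The matrix of [V^#] *)

Section IdealEntries.
Variables (S : comUnitRingType) (J : S -> Prop).
Hypothesis idJ : is_ideal J.

Lemma ideal_sum (X : Type) (s : seq X) (c : X -> S) :
  (forall i, J (c i)) -> J (\sum_(i <- s) c i).
Proof.
case: idJ => J0 [JD _] Jc; elim: s => [|i s IH]; rewrite ?big_nil ?big_cons //.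
exact: JD.
Qed.

Definition entries_in (K : S -> Prop) m n (A : 'M[S]_(m, n)) : Prop :=
  forall i j, K (A i j).

Lemma entries_in_rows (K : S -> Prop) m n (A : 'M[S]_(m, n)) :
  (forall i, entries_in K (row i A)) -> entries_in K A.
Proof. by move=> KA i j; have := KA i 0 j; rewrite mxE. Qed.

Lemma entries_in_mulr m n q (A : 'M[S]_(m, n)) (B : 'M[S]_(n, q)) :
  entries_in J A -> entries_in J (A *m B).
Proof.
move=> JA i j; rewrite mxE; apply: ideal_sum => k; rewrite mulrC.
by case: idJ => _ [_]; apply.
Qed.

Lemma entries_in_mull m n q (A : 'M[S]_(m, n)) (B : 'M[S]_(n, q)) :
  entries_in J B -> entries_in J (A *m B).
Proof.
move=> JB i j; rewrite mxE; apply: ideal_sum => k.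
by case: idJ => _ [_]; apply.
Qed.

Lemma entries_in_ideal_times (P : lmodType S) r (phi : P -> 'rV[S]_r) x :
  S_linear phi -> ideal_times J x -> entries_in J (phi x).
Proof.
move=> lphi; have [J0 [JD JM]] := idJ.
apply: (in_span_min (K := fun x => entries_in J (phi x))).
  split; first by move=> i j; rewrite (semilinear0 lphi) mxE.
  split=> [y z Jy Jz|c y Jy] i j; rewrite ?(proj1 lphi) ?(proj2 lphi) mxE.
    exact: JD.
  exact: JM.
by move=> _ [c [y [Jc ->]]] i j; rewrite (proj2 lphi) mxE mulrC; apply: JM.
Qed.

End IdealEntries.

Section TwistedPowers.
Variables (S : comUnitRingType) (sigma : {rmorphism S -> S}).

Definition twist k m n (A : 'M[S]_(m, n)) : 'M[S]_(m, n) := iter k (map_mx sigma) A.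

Lemma twistM k m n q (A : 'M[S]_(m, n)) (B : 'M[S]_(n, q)) :
  twist k (A *m B) = twist k A *m twist k B.
Proof. by elim: k => //= k IH; rewrite /twist /= -/(twist k _) IH map_mxM. Qed.

Lemma twistSr k m n (A : 'M[S]_(m, n)) : twist k.+1 A = twist k (map_mx sigma A).
Proof. exact: iterSr. Qed.

Lemma entries_in_twist (K : S -> Prop) k m n (A : 'M[S]_(m, n)) :
  (forall x, K x -> K (sigma x)) -> entries_in K A -> entries_in K (twist k A).
Proof. by move=> sK KA; elim: k => // k IH i j; rewrite mxE; apply: sK. Qed.

Fixpoint twisted_power r (C : 'M[S]_r) (k : nat) : 'M[S]_r :=
  if k is k'.+1 then C *m map_mx sigma (twisted_power C k') else 1%:M.

Lemma twisted_powerD r (C : 'M[S]_r) k l :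
  twisted_power C (k + l) = twisted_power C k *m twist k (twisted_power C l).
Proof.
elim: k => [|k IH]; first by rewrite mul1mx.
by rewrite addSn /= IH map_mxM mulmxA.
Qed.

Lemma twisted_powerSr r (C : 'M[S]_r) k :
  twisted_power C k.+1 = twisted_power C k *m twist k C.
Proof. by rewrite -addn1 twisted_powerD /= map_mx1 mulmx1. Qed.

End TwistedPowers.

Section VerschiebungMatrix.
Variables (S : comUnitRingType) (F : frame S) (W : window S).
Hypothesis hW : is_window F W.
Local Notation sigma := (fsigma F).

(* [C] is the matrix of [V^#] with respect to the generators [e] of [P] and
   [1 (x) e] of [P^(sigma)]; the equations [E C = C = C sigma(E)] normalise it. *)
Definition verschiebung_matrix r (e : 'I_r -> W) (phi : W -> 'rV[S]_r)
    (C : 'M[S]_r) : Prop :=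
  [/\ dual_basis e phi, gram e phi *m C = C, C *m map_mx sigma (gram e phi) = C &
      forall x, wQ W x -> phi (wF1 W x) *m C = map_mx sigma (phi x)].

(** The values of [v] are fixed by sigma(E): this holds on F1(Q) by the formula there, and F1(Q)
    spans. *)
Lemma verschiebung_matrix_of_linear r (e : 'I_r -> W) phi (v : W -> 'rV[S]_r) :
  dual_basis e phi -> S_linear v ->
  (forall x, wQ W x -> v (wF1 W x) = map_mx sigma (phi x)) ->
  verschiebung_matrix e phi (\matrix_(i < r) v (e i)) /\
  forall x, v x = phi x *m (\matrix_(i < r) v (e i)).
Proof.
move=> db lv vF1; set C := \matrix_(i < r) _.
have vE x : v x = phi x *m C.
  rewrite {1}(proj2 db x) (linear_lincomb _ _ lv) -lincomb_rows.
  by apply: eq_lincomb => i; rewrite rowK.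
split=> //; split=> // [||x Qx]; last by rewrite -vE vF1.
  by apply/row_matrixP => i; rewrite row_mul !rowK -vE.
apply/row_matrixP => i; rewrite row_mul !rowK; move: (e i) => {i}.
apply: (in_span_linear_eq (f := fun y => v y *m _) _ lv (window_F1_span hW)).
  by split=> *; rewrite ?(proj1 lv) ?(proj2 lv) ?mulmxDl -?scalemxAl.
by move=> _ [q [Qq ->]]; rewrite vF1 // -map_mxM dual_basis_mul_gram.
Qed.

(** [V^#] extends F1(x) |-> 1 (x) x; its compatible partner on [F] is F(x) |-> theta (1 (x) x),
    since sigma = theta sigma1 on I. *)
Lemma verschiebung_matrix_exists p r (e : 'I_r -> W) phi :
  (0 < p)%N -> is_frame p F -> dual_basis e phi ->
  exists C, verschiebung_matrix e phi C.
Proof.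
move=> p0 hF db; have [theta thetaE] := frame_theta hF; have [lphi _] := db.
have [| | | |v [lv vF1]] := window_extend (X := 'rV[S]_r)
  (g := fun x => map_mx sigma (phi x)) (f := fun x => theta *: map_mx sigma (phi x)) p0 hF hW.
- by move=> *; rewrite (proj1 lphi) map_mxD.
- by move=> *; rewrite (proj2 lphi) map_mxZ.
- split=> *; rewrite ?(proj1 lphi) ?(proj2 lphi) ?map_mxD ?scalerDr //.
  by rewrite map_mxZ !scalerA mulrC.
- by move=> c x Ic; rewrite (proj2 lphi) map_mxZ thetaE // scalerA mulrC.
exists (\matrix_(i < r) v (e i)).
by case: (verschiebung_matrix_of_linear db lv vF1).
Qed.

Lemma gram_twisted_power r (e : 'I_r -> W) phi C k : verschiebung_matrix e phi C ->
  gram e phi *m twisted_power sigma C k.+1 = twisted_power sigma C k.+1.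
Proof. by case=> _ EC _ _; rewrite /= mulmxA EC. Qed.

Lemma row_twisted_power r (e : 'I_r -> W) phi C k i : verschiebung_matrix e phi C ->
  row i (twisted_power sigma C k.+1) = phi (e i) *m twisted_power sigma C k.+1.
Proof. by move=> vC; rewrite -{1}(gram_twisted_power k vC) row_mul rowK. Qed.

(** Both sides are coordinates of the same iterate of [V^#], and [D] is the change of generators. On
    the spanning set F1(Q), the case k + 1 is the sigma-twist of the case k. *)
Lemma twisted_power_change r (e : 'I_r -> W) phi C r' (e' : 'I_r' -> W) phi' C' k x :
  verschiebung_matrix e phi C -> verschiebung_matrix e' phi' C' ->
  phi x *m twisted_power sigma C k =
  phi' x *m twisted_power sigma C' k *m twist sigma k (\matrix_(i < r') phi (e' i)).
Proof.
move=> [db _ _ vC] [db' _ _ vC']; set D := \matrix_(i < r') _.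
have [lphi _] := db; have [lphi' _] := db'.
elim: k x => [|k IH] x.
  rewrite /= !mulmx1 {1}(proj2 db' x) (linear_lincomb _ _ lphi) -lincomb_rows.
  by apply: eq_lincomb => i; rewrite rowK.
apply: (in_span_linear_eq (f := fun y => phi y *m _)
          (g := fun y => phi' y *m _ *m _) _ _ (window_F1_span hW)).
- by split=> *; rewrite ?(proj1 lphi) ?(proj2 lphi) ?mulmxDl -?scalemxAl.
- by split=> *; rewrite ?(proj1 lphi') ?(proj2 lphi') ?mulmxDl -?scalemxAl.
move=> _ [q [Qq ->]] /=; rewrite !mulmxA vC // vC' //.
by rewrite -map_mxM IH !map_mxM.
Qed.

(** The exponent grows by one because only positive twisted powers absorb the Gram matrix; the power
    0 is the identity. *)
Lemma twisted_power_ideal_change (J : S -> Prop)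
    r (e : 'I_r -> W) phi C r' (e' : 'I_r' -> W) phi' C' k :
  is_ideal J -> verschiebung_matrix e phi C -> verschiebung_matrix e' phi' C' ->
  entries_in J (twisted_power sigma C' k) -> entries_in J (twisted_power sigma C k.+1).
Proof.
move=> idJ vC vC' Jk; apply: entries_in_rows => i.
rewrite (row_twisted_power _ _ vC) (twisted_power_change _ _ vC vC').
apply: entries_in_mulr => //; apply: entries_in_mull => //.
by rewrite twisted_powerSr; apply: entries_in_mulr.
Qed.

(** The modules [N k] are known only through universal properties, which suffice to define linear
    coordinates on them, turning each iterate of [V^#] into a twisted power. *)
Lemma nilpotent_window_twisted_power (J : S -> Prop) r (e : 'I_r -> W) phi :
  is_ideal J -> nilpotent_window F J W -> dual_basis e phi ->
  exists C n, verschiebung_matrix e phi C /\ entries_in J (twisted_power sigma C n).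
Proof.
move=> idJ [N [iota0 [iotaS [v0 [vS [bc0 [bcS [lv0 [v0F1 [lvS [vS0
  [vSS [n nilJ]]]]]]]]]]]]] db.
have [lphi _] := db.
have lift0 : semilinear sigma (fun x => map_mx sigma (phi x)).
  by split=> *; rewrite ?(proj1 lphi) ?(proj2 lphi) ?map_mxD ?map_mxZ.
have [Phi0 [lPhi0 [Phi0i _]]] := proj2 bc0 _ _ lift0.
have [||vC vE] := @verschiebung_matrix_of_linear r e phi (fun x => Phi0 (v0 x)) db.
- by split=> *; rewrite ?(proj1 lv0) ?(proj2 lv0) ?(proj1 lPhi0) ?(proj2 lPhi0).
- by move=> x Qx; rewrite v0F1 // Phi0i.
(* The shift to [n.+1] occurs because [vsharp_iter] at index 0 is already [V^#]. *)
set C := \matrix_(i < r) _ in vC vE; exists C, n.+1; split=> //.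
have next k (f : N k -> 'rV[S]_r) : S_linear f ->
    exists g : N k.+1 -> 'rV[S]_r, S_linear g /\ forall y, g (iotaS k y) = map_mx sigma (f y).
  move=> lf; have lsf : semilinear sigma (fun y => map_mx sigma (f y)).
    by split=> *; rewrite ?(proj1 lf) ?(proj2 lf) ?map_mxD ?map_mxZ.
  by have [g [lg [gi _]]] := proj2 (bcS k) _ _ lsf; exists g.
have lmul k (f : N k -> 'rV[S]_r) (A : 'M[S]_r) : S_linear f -> S_linear (fun y => f y *m A).
  by move=> lf; split=> *; rewrite ?(proj1 lf) ?(proj2 lf) ?mulmxDl -?scalemxAl.
have lcomp k (f : N k.+1 -> 'rV[S]_r) : S_linear f -> S_linear (fun y => f (vS k y)).
  by move=> lf; have [D Z] := lvS k; split=> *; rewrite ?D ?Z ?(proj1 lf) ?(proj2 lf).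
(* Coordinates [f] on [N n] and [g] on [N n.+1] are built together, since [vS n] goes from one
   module to the other. *)
have [Phi [PhiS [lPhi [_ [_ [_ PhiE]]]]]] :
  exists (f : N n -> 'rV[S]_r) (g : N n.+1 -> 'rV[S]_r),
    S_linear f /\ S_linear g /\ (forall y, g (iotaS n y) = map_mx sigma (f y)) /\
    (forall y, g (vS n y) = f y *m twist sigma n.+1 C) /\
    (forall x, f (vsharp_iter v0 vS n x) = phi x *m twisted_power sigma C n.+1).
  elim: n {nilJ} => [|k [f [g [lf [lg [gi [gv fv]]]]]]].
    have [g [lg gi]] := next _ _ lPhi0; exists Phi0, g; do 3!split=> //; split.
      apply: (base_change_ext bc0 (lcomp _ _ lg) (lmul _ _ _ lPhi0)) => x.
      by rewrite vS0 gi vE Phi0i map_mxM.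
    by move=> x; rewrite [LHS]vE /= map_mx1 mulmx1.
  have [h [lh hi]] := next _ _ lg; exists g, h; do 3!split=> //; split.
    apply: (base_change_ext (bcS k) (lcomp _ _ lh) (lmul _ _ _ lg)) => y.
    by rewrite vSS hi gv gi map_mxM.
  by move=> x; rewrite /= gv fv -mulmxA -twisted_powerSr.
apply: entries_in_rows => i.
rewrite (row_twisted_power _ _ vC) -PhiE.
exact: entries_in_ideal_times.
Qed.

(** The twist P^(sigma^(k+1)) is realised by the row vectors fixed by sigma^(k+1)(E), where [V^#]
    becomes right multiplication by sigma^(k+1)(C). *)
Lemma twisted_power_nilpotent_window (J : S -> Prop) r (e : 'I_r -> W) phi C n :
  is_ideal J -> verschiebung_matrix e phi C ->
  entries_in J (twisted_power sigma C n) -> nilpotent_window F J W.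
Proof.
move=> idJ [db EC CE vC] Jn; have [lphi _] := db; set E := gram e phi in EC CE.
have EE : E *m E = E := gram_idem db.
pose T k := twist sigma k.+1 E.
have TT k : T k *m T k = T k by rewrite /T -twistM EE.
pose N k := fixmod (T k).
have lin_fix (P : lmodType S) k (f : P -> N k) :
    S_linear (fun x => fixval (f x)) -> S_linear f.
  by move=> lf; split=> *; apply: fixmod_inj; rewrite ?(proj1 lf) ?(proj2 lf).
have semi_fix (P : lmodType S) k (f : P -> N k) :
    semilinear sigma (fun x => fixval (f x)) -> semilinear sigma f.
  by move=> lf; split=> *; apply: fixmod_inj; rewrite ?(proj1 lf) ?(proj2 lf).
have iota0P x : map_mx sigma (phi x) \in fixed_pred (T 0%N).
  by rewrite unfold_in -map_mxM (dual_basis_mul_gram db).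
have iotaSP k (y : N k) : map_mx sigma y \in fixed_pred (T k.+1).
  by rewrite unfold_in -map_mxM fixmod_eq.
have v0P x : phi x *m C \in fixed_pred (T 0%N) by rewrite unfold_in -mulmxA CE.
have vSP k (y : N k) : y *m twist sigma k.+1 C \in fixed_pred (T k.+1).
  by rewrite unfold_in -mulmxA /T [twist _ k.+2 E]twistSr -twistM CE.
pose iota0 x : N 0%N := Fixmod (iota0P x).
pose iotaS k (y : N k) : N k.+1 := Fixmod (iotaSP k y).
pose v0 x : N 0%N := Fixmod (v0P x).
pose vS k (y : N k) : N k.+1 := Fixmod (vSP k y).
exists (fun k => N k), iota0, iotaS, v0, vS; split.
  apply: (dual_basis_base_change (phi' := @fixval _ _ _) db) => //.
  - by apply: semi_fix; split=> *; rewrite /= ?(proj1 lphi) ?(proj2 lphi) ?map_mxD ?map_mxZ.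
  - move=> y; apply: fixmod_inj.
    rewrite (linear_lincomb _ _ (@fixval_linear _ _ _)) -[LHS]fixmod_eq -lincomb_rows.
    by apply: eq_lincomb => i; rewrite /= -map_row rowK.
split.
  move=> k.
  apply: (dual_basis_base_change (phi' := @fixval _ _ _) (fixmod_dual_basis (TT k))) => //.
  - by apply: semi_fix; split=> *; rewrite /= ?map_mxD ?map_mxZ.
  - move=> y; apply: fixmod_inj.
    rewrite (linear_lincomb _ _ (@fixval_linear _ _ _)) -[LHS]fixmod_eq -lincomb_rows.
    by apply: eq_lincomb => i; rewrite /= -row_mul mul1mx -map_row.
split; first by apply: lin_fix; split=> *;
  rewrite /= ?(proj1 lphi) ?(proj2 lphi) ?mulmxDl -?scalemxAl.
split; first by move=> x Qx; apply: fixmod_inj; rewrite /= vC.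
split; first by move=> k; apply: lin_fix; split=> *; rewrite /= ?mulmxDl -?scalemxAl.
split; first by move=> x; apply: fixmod_inj; rewrite /= map_mxM.
split; first by move=> k y; apply: fixmod_inj; rewrite /= map_mxM.
exists n => x.
have vE k : fixval (vsharp_iter v0 vS k x) = phi x *m twisted_power sigma C k.+1.
  elim: k => [|k IH]; first by rewrite /= map_mx1 mulmx1.
  by rewrite [LHS]/= IH -mulmxA -twisted_powerSr.
rewrite (proj2 (fixmod_dual_basis (TT n)) (vsharp_iter v0 vS n x)) vE.
apply: (lincomb_submod (@ideal_times_submod _ _ J)) => i; apply: mem_ideal_times.
by apply: entries_in_mull => //; rewrite twisted_powerSr; apply: entries_in_mulr.
Qed.

End VerschiebungMatrix.

(** * Base change as reduction modulo the kernel *)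

Section FrameReduction.
Variables (p : nat) (S S' : comUnitRingType) (F : frame S) (F' : frame S').
Variables (alpha : {rmorphism S -> S'}) (u : S').
Hypothesis hF' : is_frame p F'.
Hypothesis hom : is_frame_hom F F' alpha u.
Hypothesis alphaI : forall x, fI F' (alpha x) -> fI F x.
Hypothesis alpha_surj : forall y, exists x, alpha x = y.

Local Notation sigma := (fsigma F).
Local Notation sigma1 := (fsigma1 F).
Local Notation sigma' := (fsigma F').
Local Notation sigma1' := (fsigma1 F').
Local Notation in_ker := (fun x => alpha x = 0).
Local Notation kerP := (ideal_times in_ker).

Lemma hom_unit : u \is a GRing.unit. Proof. by case: hom. Qed.

Lemma hom_I x : fI F x -> fI F' (alpha x). Proof. by case: hom => _ []; auto. Qed.

Lemma hom_sigma x : sigma' (alpha x) = alpha (sigma x).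
Proof. by case: hom => _ [_ []]. Qed.

Lemma hom_sigma1 x : fI F x -> sigma1' (alpha x) = u * alpha (sigma1 x).
Proof. by case: hom => _ [_ [_ h]]; apply: h. Qed.

Lemma map_mx_hom_sigma m n (A : 'M[S]_(m, n)) :
  map_mx sigma' (map_mx alpha A) = map_mx alpha (map_mx sigma A).
Proof. by apply/matrixP=> i j; rewrite !mxE hom_sigma. Qed.

Lemma ker_I x : alpha x = 0 -> fI F x.
Proof. by move=> x0; apply: alphaI; rewrite x0; case: (frame_ideal hF'). Qed.

Lemma ker_sigma x : alpha x = 0 -> alpha (sigma x) = 0.
Proof. by move=> x0; rewrite -hom_sigma x0 rmorph0. Qed.

(** u alpha(sigma1 x) = sigma1'(0) = 0, and [u] cancels. *)
Lemma ker_sigma1 x : alpha x = 0 -> alpha (sigma1 x) = 0.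
Proof.
move=> x0; apply: (mulrI hom_unit); rewrite -hom_sigma1 ?x0 ?mulr0; last exact: ker_I.
by rewrite -(mul0r 0) (frame_sigma1M hF') ?rmorph0 ?mul0r //; case: (frame_ideal hF').
Qed.

Lemma lift_I y : fI F' y -> exists x, fI F x /\ alpha x = y.
Proof. by have [x <-] := alpha_surj y => /alphaI Ix; exists x. Qed.

Section KernelOfWindow.
Variable W : window S.
Hypothesis hW : is_window F W.

Lemma kerP_I x : @kerP W x -> ideal_times (fI F) x.
Proof.
apply: in_span_min; first exact: ideal_times_submod.
by move=> _ [c [y [c0 ->]]]; apply: mem_ideal_times; apply: ker_I.
Qed.

Lemma kerP_Q x : @kerP W x -> wQ W x.
Proof.
apply: (in_span_min (window_Q_submod hW)) => _ [c [y [c0 ->]]].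
by apply: (window_IQ hW); apply: ker_I.
Qed.

Lemma kerP_F x : @kerP W x -> kerP (wF W x).
Proof.
have lF := window_F_semilinear hW.
apply: (in_span_min (K := fun x => kerP (wF W x))).
  split; first by rewrite (semilinear0 lF); apply: in_span0.
  by split=> *; rewrite ?(proj1 lF) ?(proj2 lF); [apply: in_spanD | apply: in_spanZ].
move=> _ [c [y [c0 ->]]]; rewrite (proj2 lF); apply: mem_ideal_times.
exact: ker_sigma.
Qed.

Lemma kerP_F1 x : @kerP W x -> kerP (wF1 W x).
Proof.
(* [F1] is additive only on [Q], so the induction also records membership in [Q]. *)
move=> kx; suff [] : wQ W x /\ kerP (wF1 W x) by [].
have [Q0 [QD QZ]] := window_Q_submod hW.
apply: (in_span_min (K := fun x => wQ W x /\ kerP (wF1 W x)) _ _ kx).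
  split; first by rewrite (window_F1_0 hW); split=> //; apply: in_span0.
  split=> [y z [Qy ky] [Qz kz]|c y [Qy ky]].
    by split; [apply: QD | rewrite (window_F1D hW) //; apply: in_spanD].
  by split; [apply: QZ | rewrite (window_F1Z hW) //; apply: in_spanZ].
move=> _ [c [y [c0 ->]]]; have Ic := ker_I c0; split; first exact: (window_IQ hW).
by rewrite (window_F1_I hW) //; apply: mem_ideal_times; apply: ker_sigma1.
Qed.

End KernelOfWindow.

Lemma kerP_linear (M N : lmodType S) (f : M -> N) x :
  S_linear f -> kerP x -> kerP (f x).
Proof.
move=> lf; apply: (in_span_min (K := fun x => kerP (f x))).
  split; first by rewrite (semilinear0 lf); apply: in_span0.
  by split=> *; rewrite ?(proj1 lf) ?(proj2 lf); [apply: in_spanD | apply: in_spanZ].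
by move=> _ [c [y [c0 ->]]]; rewrite (proj2 lf); apply: mem_ideal_times.
Qed.

Lemma semilinear_kerP (M : lmodType S) (N : lmodType S') (f : M -> N) x :
  semilinear alpha f -> kerP x -> f x = 0.
Proof.
move=> lf; apply: (in_span_min (K := fun x => f x = 0)).
  split; first exact: semilinear0 lf.
  split=> [y z fy fz|c y fy]; first by rewrite (proj1 lf) fy fz addr0.
  by rewrite (proj2 lf) fy scaler0.
by move=> _ [c [y [c0 ->]]]; rewrite (proj2 lf) c0 scale0r.
Qed.

(* The concrete form of base change: [W'] is [W] modulo the kernel of [alpha]. *)
Definition reduction (W : window S) (W' : window S') (eta : W -> W') : Prop :=
  [/\ alpha_hom alpha u eta, forall y, exists x, eta x = y,
      forall x, eta x = 0 -> kerP x &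
      forall y, wQ W' y -> exists x, wQ W x /\ eta x = y].

Section Reduction.
Variables (W : window S) (W' : window S') (eta : W -> W').
Hypotheses (hW : is_window F W) (red : reduction eta).

Let eta_semi : semilinear alpha eta. Proof. by case: red => -[]. Qed.
Let eta_Q x : wQ W x -> wQ W' (eta x). Proof. by case: red => -[_ []]; auto. Qed.
Let eta_F x : wF W' (eta x) = eta (wF W x). Proof. by case: red => -[_ [_ []]]. Qed.
Let eta_F1 x : wQ W x -> wF1 W' (eta x) = u *: eta (wF1 W x).
Proof. by case: red => -[_ [_ [_ h]]] _ _ _; apply: h. Qed.
Let eta_surj y : exists x, eta x = y. Proof. by case: red. Qed.
Let eta_ker x : eta x = 0 -> kerP x. Proof. by case: red => _ _ h _; apply: h. Qed.
Let eta_Qsurj y : wQ W' y -> exists x, wQ W x /\ eta x = y.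
Proof. by case: red => _ _ _ h; apply: h. Qed.

Lemma reduction_eq_ker x y : eta x = eta y -> kerP (x - y).
Proof. by move=> exy; apply: eta_ker; rewrite (semilinearB _ _ eta_semi) exy subrr. Qed.

(** Since aP lies in [Q], the submodule [Q] is the full preimage of its image. *)
Lemma reduction_Q x : wQ W' (eta x) -> wQ W x.
Proof.
case/eta_Qsurj => z [Qz ezx]; rewrite -(subrK z x).
apply: (proj1 (proj2 (window_Q_submod hW))) => //; apply: kerP_Q => //.
exact: reduction_eq_ker.
Qed.

(** Each axiom descends along the surjection [eta]; the unit [u] does not affect the span of the
    values of [F1]. *)
Lemma reduction_is_window : fg_projective W' -> is_window F' W'.
Proof.
move=> fgW'; split=> //.
have lF := window_F_semilinear hW; have [Q0 [QD QZ]] := window_Q_submod hW.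
split.
  split; first by rewrite -(semilinear0 eta_semi); apply: eta_Q.
  split=> [y z /eta_Qsurj[x [Qx <-]] /eta_Qsurj[w [Qw <-]]|c y /eta_Qsurj[x [Qx <-]]].
    by rewrite -(proj1 eta_semi); apply/eta_Q/QD.
  by have [d <-] := alpha_surj c; rewrite -(proj2 eta_semi); apply/eta_Q/QZ.
split.
  split=> [y z|c y].
    have [x <-] := eta_surj y; have [w <-] := eta_surj z.
    by rewrite -(proj1 eta_semi) !eta_F (proj1 lF) (proj1 eta_semi).
  have [x <-] := eta_surj y; have [d <-] := alpha_surj c.
  by rewrite -(proj2 eta_semi) !eta_F (proj2 lF) (proj2 eta_semi) hom_sigma.
split=> [y z /eta_Qsurj[x [Qx <-]] /eta_Qsurj[w [Qw <-]]|].
  rewrite -(proj1 eta_semi) !eta_F1 //; last exact: QD.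
  by rewrite (window_F1D hW) // (proj1 eta_semi) scalerDr.
split=> [c y /eta_Qsurj[x [Qx <-]]|].
  have [d <-] := alpha_surj c; rewrite -(proj2 eta_semi) !eta_F1 //; last exact: QZ.
  by rewrite (window_F1Z hW) // (proj2 eta_semi) hom_sigma !scalerA mulrC.
split; last split.
- have [pi [lpi [pipi QE]]] := window_normal_projection hW.
  have /choice[s sK] := eta_surj.
  (* [pi] preserves aP, so its reduction is independent of the chosen preimages [s]. *)
  pose pi' y := eta (pi (s y)).
  have pi'E x : pi' (eta x) = eta (pi x).
    apply/eqP; rewrite -subr_eq0 -(semilinearB _ _ eta_semi) -(semilinearB _ _ lpi).
    apply/eqP/semilinear_kerP => //; apply: kerP_linear => //.
    by apply: reduction_eq_ker; rewrite sK.
  apply: (normal_projection_decomposition (pi := pi')); split.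
    split=> [y z|c y].
      have [x <-] := eta_surj y; have [w <-] := eta_surj z.
      by rewrite -(proj1 eta_semi) !pi'E (proj1 lpi) (proj1 eta_semi).
    have [x <-] := eta_surj y; have [d <-] := alpha_surj c.
    by rewrite -(proj2 eta_semi) !pi'E (proj2 lpi) (proj2 eta_semi).
  split=> y; have [x <-] := eta_surj y; first by rewrite !pi'E pipi.
  rewrite pi'E; split=> [/reduction_Q/QE Ix|Ix].
    apply: (in_span_min (K := fun z => ideal_times (fI F') (eta z)) _ _ Ix).
      split; first by rewrite (semilinear0 eta_semi); apply: in_span0.
      by split=> *; rewrite ?(proj1 eta_semi) ?(proj2 eta_semi);
        [apply: in_spanD | apply: in_spanZ].
    move=> _ [c [z [Ic ->]]]; rewrite (proj2 eta_semi); apply: mem_ideal_times.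
    exact: hom_I.
  apply/eta_Q/QE.
  (* Elements of I' lift to I, so the combination lifts; the error lies in aP, hence in IP. *)
  have [z [Iz ezx]] : exists z, ideal_times (fI F) z /\ eta z = eta (pi x).
    apply: (in_span_min (K := fun y => exists z, ideal_times (fI F) z /\ eta z = y) _ _ Ix).
      split.
        exists 0; rewrite (semilinear0 eta_semi); split=> //.
        by apply: in_span0.
      split=> [_ _ [z [Iz <-]] [w [Iw <-]]|c _ [z [Iz <-]]].
        by exists (z + w); rewrite (proj1 eta_semi); split=> //; apply: in_spanD.
      have [d <-] := alpha_surj c.
      by exists (d *: z); rewrite (proj2 eta_semi); split=> //; apply: in_spanZ.
    move=> _ [c [z [/lift_I[d [Id <-]] ->]]]; have [w <-] := eta_surj z.
    by exists (d *: w); rewrite (proj2 eta_semi); split=> //; apply: mem_ideal_times.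
  rewrite -(subrK z (pi x)); apply: in_spanD => //; apply: kerP_I.
  exact: reduction_eq_ker.
- move=> c y /lift_I[d [Id <-]]; have [x <-] := eta_surj y.
  rewrite -(proj2 eta_semi) eta_F1; last exact: (window_IQ hW).
  by rewrite (window_F1_I hW) // (proj2 eta_semi) eta_F hom_sigma1 // scalerA.
- move=> y; have [x <-] := eta_surj y.
  apply: (in_span_min (K := fun x => in_span _ (eta x)) _ _ (window_F1_span hW x)).
    split; first by rewrite (semilinear0 eta_semi);
      apply: in_span0.
    by split=> *; rewrite ?(proj1 eta_semi) ?(proj2 eta_semi);
        [apply: in_spanD | apply: in_spanZ].
  move=> _ [q [Qq ->]].
  rewrite -[eta _]scale1r -(mulVr hom_unit) -scalerA -eta_F1 //; apply: in_spanZ.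
  by apply: mem_in_span; exists (eta q); split=> //; apply: eta_Q.
Qed.

(** An alpha-semilinear map kills aP and therefore factors through [eta]. *)
Lemma reduction_base_change : is_window F' W' ->
  is_window_base_change F' alpha u eta.
Proof.
move=> hW'; split=> //; split=> [|W'' g hW'' [lg [gQ [gF gF1]]]]; first by case: red.
have /choice[s sK] := eta_surj; pose h y := g (s y).
have hE x : h (eta x) = g x.
  apply/eqP; rewrite -subr_eq0 -(semilinearB _ _ lg).
  by apply/eqP/semilinear_kerP => //; apply: reduction_eq_ker; rewrite sK.
have lh : S_linear h.
  split=> [y z|c y].
    have [x <-] := eta_surj y; have [w <-] := eta_surj z.
    by rewrite -(proj1 eta_semi) !hE (proj1 lg).
  have [x <-] := eta_surj y; have [d <-] := alpha_surj c.
  by rewrite -(proj2 eta_semi) !hE (proj2 lg).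
exists h; split; last first.
  by split=> // h' _ h'E y; have [x <-] := eta_surj y; rewrite hE h'E.
split=> //; split=> [y /eta_Qsurj[x [Qx <-]]|]; first by rewrite hE; apply: gQ.
split=> [y|y /eta_Qsurj[x [Qx <-]]].
  by have [x <-] := eta_surj y; rewrite hE gF eta_F hE.
by rewrite hE gF1 // eta_F1 // (proj2 lh) hE.
Qed.

(** The factor u^-1 compensates for F1'(eta x) = u eta(F1 x). *)
Lemma reduction_verschiebung r (e : 'I_r -> W) phi C :
  verschiebung_matrix F e phi C ->
  exists phi', verschiebung_matrix F' (eta \o e) phi' (u^-1 *: map_mx alpha C).
Proof.
move=> [db EC CE vC]; have [lphi expand] := db.
have /choice[s sK] := eta_surj; pose phi' y := map_mx alpha (phi (s y)).
have phi'E x : phi' (eta x) = map_mx alpha (phi x).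
  apply/eqP; rewrite -subr_eq0 -map_mxB -(semilinearB _ _ lphi); apply/eqP.
  have : kerP (s (eta x) - x) by apply: reduction_eq_ker; rewrite sK.
  by apply: (semilinear_kerP (f := fun x => map_mx alpha (phi x))); split=> *;
    rewrite ?(proj1 lphi) ?(proj2 lphi) ?map_mxD ?map_mxZ.
have gramE : gram (eta \o e) phi' = map_mx alpha (gram e phi).
  by apply/row_matrixP => i; rewrite -map_row !rowK phi'E.
exists phi'; split.
- split=> [|y]; last first.
    by have [x <-] := eta_surj y; rewrite phi'E -(dual_basis_semilinear db).
  split=> [y z|c y].
    have [x <-] := eta_surj y; have [w <-] := eta_surj z.
    by rewrite -(proj1 eta_semi) !phi'E (proj1 lphi) map_mxD.
  have [x <-] := eta_surj y; have [d <-] := alpha_surj c.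
  by rewrite -(proj2 eta_semi) !phi'E (proj2 lphi) map_mxZ.
- by rewrite gramE -scalemxAr -map_mxM EC.
- by rewrite gramE map_mx_hom_sigma -scalemxAl -map_mxM CE.
- move=> y /eta_Qsurj[x [Qx <-]]; rewrite eta_F1 //.
  have [d du] := alpha_surj u; rewrite -du -(proj2 eta_semi) !phi'E (proj2 lphi) map_mxZ du.
  by rewrite -scalemxAl -scalemxAr scalerA divrr ?hom_unit // scale1r -map_mxM vC //
             map_mx_hom_sigma.
Qed.

End Reduction.

(** The unit [c] is the product of the first [k] sigma'-twists of u^-1; being a unit, it does not
    affect membership in an ideal. *)
Lemma twisted_power_reduction r (C : 'M[S]_r) k : exists c, c \is a GRing.unit /\
  twisted_power sigma' (u^-1 *: map_mx alpha C) k =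
  c *: map_mx alpha (twisted_power sigma C k).
Proof.
elim: k => [|k [c [uc IH]]]; first by exists 1; rewrite unitr1 scale1r map_mx1.
exists (u^-1 * sigma' c); split; first by rewrite unitrM unitrV hom_unit rmorph_unit.
by rewrite /= IH map_mxZ map_mx_hom_sigma -scalemxAl -scalemxAr scalerA map_mxM.
Qed.

(** The module is the image of alpha(E). [F] and [F1] are read off from arbitrary preimages, which
    is consistent because both preserve aP. *)
Lemma reduction_exists (W : window S) : is_window F W ->
  exists (W' : window S') (eta : W -> W'), is_window F' W' /\ reduction eta.
Proof.
move=> hW; have [r [e [phi db]]] := fg_projective_dual_basis (window_fg_projective hW).
have [lphi expand] := db; set E := gram e phi.
pose E' := map_mx alpha E.
have EE' : E' *m E' = E' by rewrite -map_mxM (gram_idem db).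
have etaP x : map_mx alpha (phi x) \in fixed_pred E'.
  by rewrite unfold_in -map_mxM (dual_basis_mul_gram db).
pose eta x : fixmod E' := Fixmod (etaP x).
have leta : semilinear alpha eta.
  by split=> *; apply: fixmod_inj; rewrite /= ?(proj1 lphi) ?(proj2 lphi) ?map_mxD ?map_mxZ.
have eta_surj y : exists x, eta x = y.
  have /choice[t tK] := alpha_surj.
  exists (lincomb (map_mx t (fixval y)) e).
  rewrite (semilinear_lincomb _ _ leta) [RHS](proj2 (fixmod_dual_basis EE')).
  apply: eq_bigr => i _; rewrite mxE tK; congr (_ *: _); apply: fixmod_inj.
  by rewrite fix_row_val -map_row rowK.
have eta_ker x : eta x = 0 -> kerP x.
  move/(congr1 (@fixval _ _ _)) => /= ex0; rewrite (expand x).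
  apply: (lincomb_submod (@ideal_times_submod _ _ in_ker)) => i; apply: mem_ideal_times.
  by have := congr1 (fun v : 'rV__ => v 0 i) ex0; rewrite !mxE.
have /choice[s sK] := eta_surj.
have seta x : kerP (s (eta x) - x).
  by apply: eta_ker; rewrite (semilinearB _ _ leta) sK subrr.
pose W' := @Window S' (fixmod E') (fun y => exists x, wQ W x /\ eta x = y)
  (fun y => eta (wF W (s y))) (fun y => u *: eta (wF1 W (s y))).
have red : @reduction W W' eta.
  split=> //; split=> //; split; first by move=> x Qx; exists x.
  split=> x.
    apply/eqP; rewrite -subr_eq0 /= -(semilinearB _ _ leta).
    rewrite -(semilinearB _ _ (window_F_semilinear hW)).
    by apply/eqP/semilinear_kerP => //; apply: kerP_F.
  move=> Qx; apply/eqP; rewrite -subr_eq0 /= -scalerBr -(semilinearB _ _ leta).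
  rewrite -(window_F1B hW) //.
    apply/eqP; rewrite (semilinear_kerP leta) ?scaler0 //.
    exact: kerP_F1.
  rewrite -(subrK x (s _)); apply: (proj1 (proj2 (window_Q_submod hW))) => //.
  exact: kerP_Q.
exists W', eta; split=> //; apply: (reduction_is_window hW red).
exact: fixmod_fg_projective.
Qed.

(** Comparison with the concrete reduction through both universal properties gives maps [h] and [k]
    with k h = id, which transfer the properties of the concrete model. *)
Lemma base_change_reduction (W : window S) (W' : window S') (eta : W -> W') :
  is_window F W -> is_window_base_change F' alpha u eta -> reduction eta.
Proof.
move=> hW [hW' [ahom univ]]; have [V [zeta [hV red]]] := reduction_exists hW.
have [_ [zhom zuniv]] := reduction_base_change red hV.
have [h [[lh [hQ [hF0 hF1]]] [hE _]]] := univ V zeta hV zhom.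
have [k [[lk [kQ [kF kF1]]] [kE _]]] := zuniv W' eta hW' ahom.
have khE y : k (h y) = y.
  have [i [_ [_ iuniq]]] := univ W' eta hW' ahom.
  rewrite (iuniq (fun y => k (h y))); first by rewrite [RHS](iuniq id).
    split; first by split=> *; rewrite ?(proj1 lh) ?(proj2 lh) ?(proj1 lk) ?(proj2 lk).
    split=> [x Qx|]; first by apply/kQ/hQ.
    split=> [x|x Qx]; first by rewrite kF hF0.
    by rewrite kF1 ?hF1 //; apply: hQ.
  by move=> x; rewrite hE kE.
have [_ zsurj zker zQ] := red; split=> //.
- by move=> y; have [x zx] := zsurj (h y); exists x; rewrite -kE zx khE.
- by move=> x ex0; apply: zker; rewrite -hE ex0 (semilinear0 lh).
- by move=> y /hQ/zQ[x [Qx zx]]; exists x; split=> //; rewrite -kE zx khE.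
Qed.

End FrameReduction.

(** * Full faithfulness *)

Section IdealPower.
Variables (S : comUnitRingType) (J : S -> Prop).

(** The ideal power J^m in closure form, giving induction on membership; J^0 is the unit ideal. *)
Inductive ideal_pow : nat -> S -> Prop :=
| ideal_pow_all x : ideal_pow 0 x
| ideal_pow_mul m c x : J c -> ideal_pow m x -> ideal_pow m.+1 (c * x)
| ideal_pow_zero m : ideal_pow m 0
| ideal_pow_add m x y : ideal_pow m x -> ideal_pow m y -> ideal_pow m (x + y).

Lemma ideal_pow_ideal m : is_ideal (ideal_pow m).
Proof.
split; first exact: ideal_pow_zero.
split=> [x y|s x]; first exact: ideal_pow_add.
elim=> [y|k c y Jc _ IH|k|k y z _ IHy _ IHz].
- exact: ideal_pow_all.
- by rewrite mulrCA; apply: ideal_pow_mul.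
- by rewrite mulr0; apply: ideal_pow_zero.
- by rewrite mulrDr; apply: ideal_pow_add.
Qed.

Lemma ideal_pow_rmorph (sigma : {rmorphism S -> S}) m x :
  (forall c, J c -> J (sigma c)) -> ideal_pow m x -> ideal_pow m (sigma x).
Proof.
move=> sJ; elim=> [y|k c y Jc _ IH|k|k y z _ IHy _ IHz].
- exact: ideal_pow_all.
- by rewrite rmorphM; apply: ideal_pow_mul => //; apply: sJ.
- by rewrite rmorph0; apply: ideal_pow_zero.
- by rewrite rmorphD; apply: ideal_pow_add.
Qed.

(** The induction is generalised over a list of factors from [J] already split off. *)
Lemma ideal_pow_annihilates m x y :
  (forall js, size js = m -> List.Forall J js -> \prod_(j <- js) j * y = 0) ->
  ideal_pow m x -> x * y = 0.
Proof.
move=> ann px.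
suff prod0 k z : ideal_pow k z -> forall js, (size js + k)%N = m ->
    List.Forall J js -> \prod_(j <- js) j * (z * y) = 0.
  by have := prod0 m x px [::] erefl; rewrite big_nil mul1r; apply; constructor.
elim=> {k z} [z|k c z Jc _ IH|k|k z w _ IHz _ IHw] js szjs Jjs.
- by rewrite mulrCA ann ?mulr0 // -szjs addn0.
- rewrite -mulrA mulrA [_ * c]mulrC -(big_cons _ _ c js xpredT id) IH //.
    by rewrite -szjs addnS.
  by constructor.
- by rewrite mul0r mulr0.
- by rewrite mulrDl mulrDr IHz // IHw // addr0.
Qed.

(** Each block of [n] consecutive factors contributes one factor from [J], as sigma preserves
    [J]. *)
Lemma twisted_power_ideal_pow (sigma : {rmorphism S -> S}) r (C : 'M[S]_r) n m :
  (forall c, J c -> J (sigma c)) -> entries_in J (twisted_power sigma C n) ->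
  entries_in (ideal_pow m) (twisted_power sigma C (n * m)).
Proof.
move=> sJ Jn; elim: m => [|m IH]; first by move=> i j; apply: ideal_pow_all.
rewrite mulnS twisted_powerD => i j; rewrite mxE.
apply: (ideal_sum (ideal_pow_ideal _)) => k; apply: ideal_pow_mul => //.
by apply: entries_in_twist => // x; apply: ideal_pow_rmorph.
Qed.

End IdealPower.

(** * The fixed-point equation for corrections with values in aP *)

Section NilpotentDeformation.
Variables (p : nat) (S S' : comUnitRingType) (F : frame S) (F' : frame S').
Variables (alpha : {rmorphism S -> S'}) (u : S') (J : S -> Prop).
Hypotheses (p_gt0 : (0 < p)%N) (hF : is_frame p F) (hF' : is_frame p F').
Hypothesis hom : is_frame_hom F F' alpha u.
Hypothesis alphaI : forall x, fI F' (alpha x) -> fI F x.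
Hypothesis sigmaJ : forall x, J x -> J (fsigma F x).
Variable m : nat.
Hypothesis J_ker : forall js x, size js = m -> List.Forall J js ->
  alpha x = 0 -> \prod_(j <- js) j * x = 0.

Local Notation sigma := (fsigma F).
Local Notation in_ker := (fun x => alpha x = 0).
Local Notation kerP := (ideal_times in_ker).

Variables (W1 W2 : window S).
Hypotheses (hW1 : is_window F W1) (hW2 : is_window F W2).
Variables (r : nat) (e : 'I_r -> W1) (phi : W1 -> 'rV[S]_r) (C : 'M[S]_r) (n : nat).
Hypothesis vC : verschiebung_matrix F e phi C.
Hypothesis nilC : entries_in J (twisted_power sigma C n).

(* The composite of [V^#] with the linear extension of [F1 \o w]; a homomorphism
   [w] with values in the kernel is the same thing as a fixed point. *)
Definition frob_transform (w : W1 -> W2) (x : W1) : W2 :=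
  lincomb (phi x *m C) (fun i => wF1 W2 (w (e i))).

Let phi_linear : S_linear phi. Proof. by case: vC => -[]. Qed.

Lemma frob_transform_linear w : S_linear (frob_transform w).
Proof.
split=> *; rewrite /frob_transform ?(proj1 phi_linear) ?(proj2 phi_linear).
  by rewrite mulmxDl (proj1 (lincomb_linear _)).
by rewrite -scalemxAl (proj2 (lincomb_linear _)).
Qed.

Lemma frob_transform_ker w x :
  (forall x, kerP (w x)) -> kerP (frob_transform w x).
Proof.
move=> kw; apply: (lincomb_submod (@ideal_times_submod _ _ in_ker)) => i.
by apply: in_spanZ; apply: (kerP_F1 hF' hom alphaI hW2).
Qed.

Lemma frob_transform_F1 w x : S_linear w -> (forall x, kerP (w x)) ->
  wQ W1 x -> frob_transform w (wF1 W1 x) = wF1 W2 (w x).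
Proof.
move=> lw kw Qx; have [db _ _ vF1] := vC; rewrite /frob_transform vF1 //.
rewrite {2}(proj2 db x) (linear_lincomb _ _ lw) lincomb_map_mx (window_F1_sum hW2) //.
by move=> i; apply: (kerP_Q hF' alphaI hW2); apply: kw.
Qed.

Lemma frob_transformB w w' x : (forall x, kerP (w x)) -> (forall x, kerP (w' x)) ->
  frob_transform w x - frob_transform w' x = frob_transform (fun x => w x - w' x) x.
Proof.
move=> kw kw'; rewrite /frob_transform -sumrB; apply: eq_bigr => i _.
by rewrite -scalerBr -(window_F1B hW2) //; apply: (kerP_Q hF' alphaI hW2).
Qed.

Lemma iter_F1_ker k x : @kerP W2 x -> kerP (iter k (wF1 W2) x).
Proof. by move=> kx; elim: k => //= k; apply: (kerP_F1 hF' hom alphaI hW2). Qed.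

Lemma iter_frob_transform k w x : S_linear w -> (forall x, kerP (w x)) ->
  iter k frob_transform w x =
  lincomb (phi x *m twisted_power sigma C k) (fun i => iter k (wF1 W2) (w (e i))).
Proof.
move=> lw kw; have [db EC CE _] := vC; elim: k x => [|k IH] x.
  by rewrite /= mulmx1 {1}(proj2 db x) (linear_lincomb _ _ lw).
(* C = C sigma(E) inserts a Gram matrix, whose rows are the coordinates of the [e i]; the induction
   hypothesis then applies at each [e i]. *)
have -> : phi x *m twisted_power sigma C k.+1 =
    phi x *m C *m map_mx sigma (gram e phi *m twisted_power sigma C k).
  by rewrite /= map_mxM !mulmxA -(mulmxA (phi x) C (map_mx sigma (gram e phi))) CE.
rewrite lincomb_mulmx iterS {1}/frob_transform; apply: eq_lincomb => i.
rewrite IH (window_F1_sum hW2).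
  by rewrite -map_row row_mul rowK lincomb_map_mx.
by move=> j; apply: (kerP_Q hF' alphaI hW2); apply: iter_F1_ker.
Qed.

(** The coefficients of this iterate lie in J^m and its vectors in aP. *)
Lemma iter_frob_transform_nil w x : S_linear w -> (forall x, kerP (w x)) ->
  iter (n * m) frob_transform w x = 0.
Proof.
move=> lw kw; rewrite iter_frob_transform // /lincomb big1 // => i _.
have pow_c : ideal_pow J m ((phi x *m twisted_power sigma C (n * m)) 0 i).
  apply: (entries_in_mull (ideal_pow_ideal J m)).
  exact: twisted_power_ideal_pow.
have := iter_F1_ker (n * m) (kw (e i)).
apply: (in_span_min (K := fun y => _ *: y = 0)).
  split; first by rewrite scaler0.
  split=> [y z cy cz|d y cy]; first by rewrite scalerDr cy cz addr0.
  by rewrite scalerA mulrC -scalerA cy scaler0.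
move=> _ [d [y [d0 ->]]]; rewrite scalerA (ideal_pow_annihilates _ pow_c) ?scale0r //.
by move=> js szjs Jjs; apply: J_ker.
Qed.

Lemma frob_transform_solve h : S_linear h -> (forall x, kerP (h x)) ->
  exists w : W1 -> W2, [/\ S_linear w, forall x, kerP (w x) &
    forall x, w x = h x + frob_transform w x].
Proof.
move=> lh kh; pose step w x := h x + frob_transform w x.
(* [ws k] is the partial sum h + U h + ... + U^(k-1) h of the Neumann series, which is stationary
   from index n m on. *)
pose ws k := iter k step (fun=> 0).
have wsP k : S_linear (ws k) /\ forall x, kerP (ws k x).
  elim: k => [|k [lw kw]].
    split; first by split=> *; rewrite /= ?addr0 ?scaler0.
    by move=> x; apply: in_span0.
  have [lD lZ] := frob_transform_linear (ws k); split.
    split=> *; rewrite /ws /= -/(ws k) /step.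
      by rewrite (proj1 lh) lD addrACA.
    by rewrite (proj2 lh) lZ scalerDr.
  by move=> x; apply: in_spanD; [apply: kh | apply: (frob_transform_ker x kw)].
have diff k x : ws k.+1 x - ws k x = iter k frob_transform h x.
  elim: k x => [|k IH] x.
    rewrite /ws /= subr0 /step /frob_transform /lincomb big1 ?addr0 // => i _.
    by rewrite (window_F1_0 hW2) scaler0.
  rewrite {1}/ws /= -/(ws k.+1) {1}/step {1}/ws /= -/(ws k) {2}/step opprD addrACA subrr add0r.
  rewrite frob_transformB; first last.
  - by case: (wsP k).
  - by case: (wsP k.+1).
  by apply: eq_lincomb => i; rewrite IH.
exists (ws (n * m)); have [lw kw] := wsP (n * m)%N; split=> // x.
apply/eqP; rewrite eq_sym -subr_eq0; apply/eqP.
by rewrite -[LHS]/(ws (n * m).+1 x - _) diff iter_frob_transform_nil.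
Qed.

(** Compatibility with [F] follows, as [F] is a combination of values of [F1]. *)
Lemma window_hom_F (f : W1 -> W2) : S_linear f -> (forall x, wQ W1 x -> wQ W2 (f x)) ->
  (forall x, wQ W1 x -> wF1 W2 (f x) = f (wF1 W1 x)) -> window_hom f.
Proof.
move=> lf fQ fF1; split=> //; split=> //; split=> // x.
have [_ [_ [_ [_ [_ gen]]]]] := hF; have [l [Il l1]] := gen 1.
rewrite (window_F_of_F1 hW1 _ Il l1) (window_F_of_F1 hW2 _ Il l1) (semilinear_sum _ _ _ lf).
elim: Il {l1} => [|q l' Iq _ IH]; first by rewrite !big_nil.
by rewrite !big_cons IH -(proj2 lf) fF1 //; apply: (window_IQ hW1).
Qed.

(** Such a map satisfies w = U w, so w = U^(nm) w = 0. *)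
Lemma frob_transform_unique w : S_linear w -> (forall x, kerP (w x)) ->
  (forall x, wQ W1 x -> wF1 W2 (w x) = w (wF1 W1 x)) -> forall x, w x = 0.
Proof.
move=> lw kw wF1 x.
have fixw : forall x, frob_transform w x = w x.
  apply: (in_span_linear_eq (frob_transform_linear w) lw (window_F1_span hW1)).
  by move=> _ [q [Qq ->]]; rewrite frob_transform_F1 // wF1.
rewrite -(iter_frob_transform_nil x lw kw); elim: (n * m)%N x => //= k IH x.
by rewrite -[LHS]fixw; apply: eq_lincomb => i; rewrite -IH.
Qed.

Section Homomorphisms.
Variables (W2' : window S') (eta : W2 -> W2').
Hypothesis red : reduction alpha u eta.

Lemma reduction_faithful (f f' : W1 -> W2) : window_hom f -> window_hom f' ->
  (forall x, eta (f x) = eta (f' x)) -> forall x, f x = f' x.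
Proof.
move=> [lf [fQ [_ fF1]]] [lf' [fQ' [_ fF1']]] eqf x.
apply/eqP; rewrite -subr_eq0; apply/eqP; move: x.
apply: (frob_transform_unique (w := fun x => f x - f' x)).
- split=> *; first by rewrite (proj1 lf) (proj1 lf') opprD addrACA.
  by rewrite (proj2 lf) (proj2 lf') scalerBr.
- by move=> x; apply: (reduction_eq_ker red).
- by move=> x Qx; rewrite (window_F1B hW2) ?fF1 ?fF1' //; [apply: fQ | apply: fQ'].
Qed.

Lemma reduction_full (g : W1 -> W2') : alpha_hom alpha u g ->
  exists f : W1 -> W2, window_hom f /\ forall x, eta (f x) = g x.
Proof.
move=> [lg [gQ [gF gF1]]]; have [[leta [etaQ [etaF etaF1]]] eta_surj eta_ker _] := red.
have [db _ _ _] := vC; have /choice[s sK] := eta_surj.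
(* A linear lift of [g] made from preimages on the dual basis; it need not commute with [F1]. *)
pose f0 x := lincomb (phi x) (fun i => s (g (e i))).
have lf0 : S_linear f0.
  split=> *; rewrite /f0 ?(proj1 phi_linear) ?(proj2 phi_linear).
    by rewrite (proj1 (lincomb_linear _)).
  by rewrite (proj2 (lincomb_linear _)).
have f0E x : eta (f0 x) = g x.
  rewrite (semilinear_lincomb _ _ leta) {2}(proj2 db x) (semilinear_lincomb _ _ lg).
  by apply: eq_bigr => i _; rewrite sK.
have f0Q x : wQ W1 x -> wQ W2 (f0 x).
  by move=> Qx; apply: (reduction_Q hF' alphaI hW2 red); rewrite f0E; apply: gQ.
have lF1 := window_F_semilinear hW1; have lF2 := window_F_semilinear hW2.
have [Q0 [QD QZ]] := window_Q_submod hW1.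
(* The failure to commute with [F1] extends to a linear map [h], which vanishes modulo the
   kernel. *)
have [||||h [lh hF1]] := window_extend (X := W2)
  (g := fun x => wF1 W2 (f0 x) - f0 (wF1 W1 x))
  (f := fun x => wF W2 (f0 x) - f0 (wF W1 x)) p_gt0 hF hW1.
- move=> x y Qx Qy; rewrite (window_F1D hW1) // !(proj1 lf0) (window_F1D hW2); try exact: f0Q.
  by rewrite opprD addrACA.
- move=> c x Qx; rewrite (window_F1Z hW1) // !(proj2 lf0) (window_F1Z hW2); last exact: f0Q.
  by rewrite scalerBr.
- split=> *; rewrite ?(proj1 lF1, proj1 lf0, proj1 lF2) ?(proj2 lF1, proj2 lf0, proj2 lF2).
    by rewrite opprD addrACA.
  by rewrite scalerBr.
- move=> c x Ic; rewrite (proj2 lf0) (window_F1_I hW1) // (window_F1_I hW2) //.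
  by rewrite (proj2 lf0) scalerBr.
have kh x : kerP (h x).
  apply: eta_ker.
  apply: (in_span_min (K := fun x => eta (h x) = 0) _ _ (window_F1_span hW1 x)).
    split; first by rewrite (semilinear0 lh) (semilinear0 leta).
    split=> [y z hy hz|c y hy]; first by rewrite (proj1 lh) (proj1 leta) hy hz addr0.
    by rewrite (proj2 lh) (proj2 leta) hy scaler0.
  move=> _ [q [Qq ->]]; rewrite hF1 // (semilinearB _ _ leta) f0E.
  rewrite -[eta _]scale1r -(mulVr (hom_unit hom)) -scalerA -etaF1; last exact: f0Q.
  by rewrite f0E gF1 // scalerA mulVr ?(hom_unit hom) // scale1r subrr.
(* On F1(x) the equation w = h + U w says exactly that [f0 + w] commutes with [F1]. *)
have [w [lw kw wE]] := frob_transform_solve lh kh.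
exists (fun x => f0 x + w x); split; last first.
  by move=> x; rewrite (proj1 leta) f0E (semilinear_kerP leta (kw x)) addr0.
have wQ2 x : wQ W2 (w x) by apply: (kerP_Q hF' alphaI hW2).
apply: window_hom_F.
- split=> *; first by rewrite (proj1 lf0) (proj1 lw) addrACA.
  by rewrite (proj2 lf0) (proj2 lw) scalerDr.
- by move=> x Qx; apply: (proj1 (proj2 (window_Q_submod hW2))) => //; apply: f0Q.
- move=> x Qx; rewrite (window_F1D hW2) //; last exact: f0Q.
  by rewrite (wE (wF1 W1 x)) hF1 // frob_transform_F1 // addrA (addrC (f0 _)) subrK.
Qed.

End Homomorphisms.

End NilpotentDeformation.

(** * Essential surjectivity *)

Section IdempotentLifting.
Variables (S S' : comUnitRingType) (alpha : {rmorphism S -> S'}) (N : nat) (r : nat).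
Hypothesis alpha_surj : forall y, exists x, alpha x = y.
Hypothesis ker_nil : forall js, size js = N ->
  List.Forall (fun x => alpha x = 0) js -> \prod_(j <- js) j = 0.

(** Entries of D^N are sums of products of N kernel elements; the induction collects these factors
    in a list. *)
Lemma ker_mx_nilpotent (D : 'M[S]_r) : map_mx alpha D = 0 -> D ^+ N = 0.
Proof.
move=> D0; have kD i j : alpha (D i j) = 0.
  by have := congr1 (fun A : 'M__ => A i j) D0; rewrite !mxE.
suff prod0 k js i j : (size js + k)%N = N -> List.Forall (fun x => alpha x = 0) js ->
    \prod_(c <- js) c * (D ^+ k) i j = 0.
  apply/matrixP=> i j; have := prod0 N [::] i j erefl.
  by rewrite big_nil mul1r mxE; apply; constructor.
elim: k js i j => [|k IH] js i j szjs kjs.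
  by rewrite ker_nil ?mul0r // -szjs addn0.
rewrite exprS mxE mulr_sumr big1 // => l _.
rewrite mulrA [_ * D i l]mulrC -(big_cons _ _ (D i l) js xpredT id) IH //.
  by rewrite -szjs addnS.
by constructor.
Qed.

Lemma expr_idem (R : pzRingType) (x : R) k : x * x = x -> x ^+ k.+1 = x.
Proof. by move=> xx; elim: k => [|k IH]; rewrite ?expr1 // exprS IH. Qed.

(* If [M] lifts [E'] then [M (1 - M)] is nilpotent, and [1 - (1 - M^N)^N] is
   divisible by [M^N] while its complement is divisible by [(1 - M)^N]. *)
Lemma idempotent_lift (E' : 'M[S']_r) : (0 < N)%N -> E' *m E' = E' ->
  exists E : 'M[S]_r, E *m E = E /\ map_mx alpha E = E'.
Proof.
move=> N_gt0 EE'; have /choice[t tK] := alpha_surj.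
pose M : 'M[S]_r := map_mx t E'.
have aM : map_mx alpha M = E' by apply/matrixP=> i j; rewrite !mxE tK.
have MN : (M * (1 - M)) ^+ N = 0.
  apply: ker_mx_nilpotent.
  by rewrite [M * _]mulmxBr mulmx1 map_mxB map_mxM aM EE' subrr.
have cM1 : GRing.comm M (1 - M) by apply: commrB; [apply: commr1 | apply: commr_refl].
pose c := M ^+ N; pose y := 1 - c; pose E := 1 - y ^+ N.
have [s sE] : exists s, y ^+ N = (1 - M) ^+ N * s.
  pose s := \sum_(i < N) M ^+ i.
  have yE : y = (1 - M) * s by rewrite /y /c -opprB subrX1 -mulNr opprB.
  exists (s ^+ N); rewrite yE exprMn_comm //.
  apply: commr_sum => i _; apply: commrX; apply: commr_sym.
  by apply: commrB; [apply: commr1 | apply: commr_refl].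
have [s' s'E] : exists s', E = s' * M ^+ N.
  pose s' := \sum_(i < N) y ^+ i; exists s'.
  have ys' : GRing.comm (y - 1) s'.
    apply: commr_sum => i _; apply: commrX; apply: commr_sym.
    by apply: commrB; [apply: commr_refl | apply: commr1].
  by rewrite /E -opprB subrX1 ys' -mulrN opprB /y opprB addrC subrK.
(* The product is s' M^N (1 - M)^N s, whose middle part is the N-th power of M (1 - M). *)
have E1E : E * (1 - E) = 0.
  rewrite {2}/E opprB addrC subrK sE s'E -mulrA (mulrA (M ^+ N)) -exprMn_comm //.
  by rewrite MN mul0r mulr0.
exists E; split.
  by move/eqP: E1E; rewrite mulrBr mulr1 subr_eq0 => /eqP/esym.
have map_exp (A : 'M[S]_r) k : map_mx alpha (A ^+ k) = (map_mx alpha A) ^+ k.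
  by elim: k => [|k IH]; rewrite ?expr0 ?map_mx1 // !exprS -IH; apply: map_mxM.
rewrite /E /y /c map_mxB map_mx1 !(map_exp, map_mxB, map_mx1) aM -(prednK N_gt0).
have EE1 : (1 - E') * (1 - E') = 1 - E'.
  by rewrite mulrBl mul1r mulrBr mulr1 [E' * E']EE' subrr subr0.
by rewrite (expr_idem _ (EE' : E' * E' = E')) (expr_idem _ EE1) opprB addrC subrK.
Qed.

End IdempotentLifting.

Lemma prod_fg_projective (S : comUnitRingType) (M N : lmodType S) :
  fg_projective M -> fg_projective N -> fg_projective (M * N)%type.
Proof.
move=> [[gM genM] projM] [[gN genN] projN].
have linl : S_linear (fun x : M => (x, 0) : M * N).
  by split=> *; congr (_, _); rewrite ?addr0 ?scaler0.
have linr : S_linear (fun y : N => (0, y) : M * N).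
  by split=> *; congr (_, _); rewrite ?addr0 ?scaler0.
have pairE (z : M * N) : z = (z.1, 0) + (0, z.2).
  by case: z => x y; congr (_, _); rewrite /= ?addr0 ?add0r.
split.
  exists ([seq (x, 0) | x <- gM] ++ [seq (0, y) | y <- gN]) => z.
  rewrite [z]pairE; set G := (G in in_span G _); apply: in_spanD.
    apply: (in_span_min (K := fun x => in_span G (x, 0)) _ _ (genM z.1)).
      split; first by apply: in_span0.
      by split=> *; rewrite ?(proj1 linl) ?(proj2 linl); [apply: in_spanD | apply: in_spanZ].
    move=> x /List_InP gx; apply: mem_in_span; apply/List_InP.
    by rewrite mem_cat map_f.
  apply: (in_span_min (K := fun y => in_span G (0, y)) _ _ (genN z.2)).
    split; first by apply: in_span0.
    by split=> *; rewrite ?(proj1 linr) ?(proj2 linr); [apply: in_spanD | apply: in_spanZ].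
  move=> y /List_InP gy; apply: mem_in_span; apply/List_InP.
  by rewrite mem_cat map_f ?orbT.
move=> A B pi f lpi spi lf.
have [|g [lg gE]] := projM A B pi (fun x => f (x, 0)) lpi spi.
  by split=> *; rewrite ?(proj1 linl) ?(proj2 linl) ?(proj1 lf) ?(proj2 lf).
have [|h [lh hE]] := projN A B pi (fun y => f (0, y)) lpi spi.
  by split=> *; rewrite ?(proj1 linr) ?(proj2 linr) ?(proj1 lf) ?(proj2 lf).
exists (fun z => g z.1 + h z.2); split.
  split=> *; first by rewrite /= (proj1 lg) (proj1 lh) addrACA.
  by rewrite /= (proj2 lg) (proj2 lh) scalerDr.
by move=> z; rewrite (proj1 lpi) gE hE -(proj1 lf) -pairE.
Qed.

(** * Lifting windows along the reduction *)

Section WindowLifting.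
Variables (p : nat) (S S' : comUnitRingType) (F : frame S) (F' : frame S').
Variables (alpha : {rmorphism S -> S'}) (u : S') (N : nat).
Hypotheses (hF : is_frame p F) (hF' : is_frame p F').
Hypothesis hom : is_frame_hom F F' alpha u.
Hypothesis alphaI : forall x, fI F' (alpha x) -> fI F x.
Hypothesis alpha_surj : forall y, exists x, alpha x = y.
Hypothesis N_gt0 : (0 < N)%N.
Hypothesis ker_nil : forall js, size js = N ->
  List.Forall (fun x => alpha x = 0) js -> \prod_(j <- js) j = 0.
Local Notation sigma := (fsigma F).
Local Notation sigma1 := (fsigma1 F).
Local Notation sigma' := (fsigma F').
Local Notation sigma1' := (fsigma1 F').
Local Notation in_ker := (fun x => alpha x = 0).
Local Notation kerP := (ideal_times in_ker).

(** The matrix of [q] in dual basis coordinates is idempotent; the image of an idempotent lift [E]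
    lifts the summand cut out by [q]. *)
Lemma lift_summand (P' : lmodType S') r (e : 'I_r -> P') phi (q : P' -> P') :
  dual_basis e phi -> S_linear q -> (forall x, q (q x) = q x) ->
  exists E : 'M[S]_r, [/\ E *m E = E,
    forall v : fixmod E, phi (lincomb (map_mx alpha v) (q \o e)) = map_mx alpha v &
    forall y, q y = y -> exists v : fixmod E, lincomb (map_mx alpha v) (q \o e) = y].
Proof.
move=> db lq qq; have [lphi expand] := db.
pose E' := \matrix_(i < r) phi (q (e i)).
have phiE' x : phi x *m E' = phi (q x).
  rewrite {2}(expand x) (linear_lincomb _ _ lq) (linear_lincomb _ _ lphi) -lincomb_rows.
  by apply: eq_lincomb => i; rewrite rowK.
have EE' : E' *m E' = E'.
  by apply/row_matrixP => i; rewrite row_mul !rowK phiE' qq.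
have [E [EE aE]] := idempotent_lift alpha_surj ker_nil N_gt0 EE'.
exists E; split=> // [v|y qy].
  rewrite (linear_lincomb _ _ lphi) -{2}(fixmod_eq v) map_mxM aE -lincomb_rows.
  by apply: eq_lincomb => i; rewrite rowK.
have /choice[t tK] := alpha_surj.
exists (fix_proj EE (map_mx t (phi y))) => /=.
have -> : map_mx alpha (map_mx t (phi y) *m E) = phi y.
  rewrite map_mxM aE; have -> : map_mx alpha (map_mx t (phi y)) = phi y.
    by apply/matrixP=> i j; rewrite !mxE tK.
  by rewrite phiE' qy.
by rewrite -(linear_lincomb _ _ lq) -expand.
Qed.

Lemma reduction_lift (W' : window S') : is_window F' W' ->
  exists (W : window S) (eta : W -> W'), is_window F W /\ reduction alpha u eta.
Proof.
move=> hW'.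
have [r [e [phi db]]] := fg_projective_dual_basis (window_fg_projective hW').
have [lphi expand] := db.
have [piT [lT [piTT QE']]] := window_normal_projection hW'.
pose piL x := x - piT x.
have lL : S_linear piL.
  split=> *; first by rewrite /piL (proj1 lT) opprD addrACA.
  by rewrite /piL (proj2 lT) scalerBr.
have piLT x : piL (piT x) = 0 by rewrite /piL piTT subrr.
have piTL x : piT (piL x) = 0 by rewrite /piL (semilinearB _ _ lT) piTT subrr.
have piLL x : piL (piL x) = piL x by rewrite {1}/piL piTL subr0.
have piLQ x : wQ W' (piL x).
  by apply/QE'; rewrite piTL; apply: in_span0.
have [EL [ELL phiL surjL]] := lift_summand db lL piLL.
have [ET [ETT phiT surjT]] := lift_summand db lT piTT.
pose P : lmodType S := (fixmod EL * fixmod ET)%type.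
pose etaL (v : fixmod EL) := lincomb (map_mx alpha v) (piL \o e).
pose etaT (w : fixmod ET) := lincomb (map_mx alpha w) (piT \o e).
pose eta (x : P) : W' := etaL x.1 + etaT x.2.
have letaL : semilinear alpha etaL.
  split=> *; rewrite /etaL /= ?map_mxD ?map_mxZ.
    by rewrite (proj1 (lincomb_linear _)).
  by rewrite (proj2 (lincomb_linear _)).
have letaT : semilinear alpha etaT.
  split=> *; rewrite /etaT /= ?map_mxD ?map_mxZ.
    by rewrite (proj1 (lincomb_linear _)).
  by rewrite (proj2 (lincomb_linear _)).
have leta : semilinear alpha eta.
  split=> *; first by rewrite /eta /= (proj1 letaL) (proj1 letaT) addrACA.
  by rewrite /eta /= (proj2 letaL) (proj2 letaT) scalerDr.
have piT_etaT w : piT (etaT w) = etaT w.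
  by rewrite (linear_lincomb _ _ lT); apply: eq_lincomb => i /=; rewrite piTT.
have piT_etaL v : piT (etaL v) = 0.
  rewrite (linear_lincomb _ _ lT) /lincomb big1 // => i _ /=.
  by rewrite piTL scaler0.
have piT_eta x : piT (eta x) = etaT x.2.
  by rewrite (proj1 lT) piT_etaL piT_etaT add0r.
have eta_surj y : exists x, eta x = y.
  have [v vE] := surjL _ (piLL y); have [w wE] := surjT _ (piTT y).
  by exists (v, w); rewrite /eta /etaL /etaT /= vE wE subrK.
have linl : S_linear (fun v : fixmod EL => (v, 0) : P).
  by split=> *; congr (_, _); rewrite ?addr0 ?scaler0.
have linr : S_linear (fun w : fixmod ET => (0, w) : P).
  by split=> *; congr (_, _); rewrite ?addr0 ?scaler0.
have sndE (w : fixmod ET) : (0, w) = lincomb (fixval w) (fun i => (0, fix_row ETT i) : P).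
  by rewrite -(linear_lincomb _ _ linr) -(proj2 (fixmod_dual_basis ETT)).
have fstE (v : fixmod EL) : (v, 0) = lincomb (fixval v) (fun i => (fix_row ELL i, 0) : P).
  by rewrite -(linear_lincomb _ _ linl) -(proj2 (fixmod_dual_basis ELL)).
have pairE (x : P) : x = (x.1, 0) + (0, x.2).
  by case: x => v w; congr (_, _); rewrite /= ?addr0 ?add0r.
have eta_ker x : eta x = 0 -> kerP x.
  move=> ex0; have eT : etaT x.2 = 0 by rewrite -piT_eta ex0 (semilinear0 lT).
  have eL : etaL x.1 = 0 by move: ex0; rewrite /eta eT addr0.
  rewrite [x]pairE fstE sndE; apply: in_spanD;
    apply: (lincomb_submod (@ideal_times_submod _ _ in_ker)) => i; apply: mem_ideal_times.
    have := phiL x.1; rewrite -/(etaL _) eL (semilinear0 lphi).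
    by move/(congr1 (fun v : 'rV__ => v 0 i)); rewrite !mxE => ->.
  have := phiT x.2; rewrite -/(etaT _) eT (semilinear0 lphi).
  by move/(congr1 (fun v : 'rV__ => v 0 i)); rewrite !mxE => ->.
have /choice[s sK] := eta_surj.
(* Psi is lifted on generators; u^-1 is the normalisation forced by F1'(eta x) = u eta(F1 x). *)
pose yL i : P := s (u^-1 *: wF1 W' (piL (e i))).
pose zT i : P := s (wF W' (piT (e i))).
have [theta thetaE] := frame_theta hF.
(* This is L + IT: a vector of the summand [T] lies in IT exactly when its coordinates lie in I. *)
pose Q (x : P) := forall i, fI F (fixval x.2 0 i).
(* On [L], inside [Q], the relation F = theta F1 forces this value. *)
pose Fr (x : P) : P := theta *: (\sum_i sigma (fixval x.1 0 i) *: yL i)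
                       + \sum_i sigma (fixval x.2 0 i) *: zT i.
pose F1 (x : P) : P := \sum_i sigma (fixval x.1 0 i) *: yL i
                       + \sum_i sigma1 (fixval x.2 0 i) *: zT i.
pose W := @Window S P Q Fr F1.
have [I0 [ID IM]] := frame_ideal hF.
have idI' := frame_ideal hF'.
have QE x : Q x <-> wQ W' (eta x).
  rewrite QE' piT_eta; split=> [Qx|Ix i].
    apply: (lincomb_submod (@ideal_times_submod _ _ (fI F'))) => i.
    by apply: mem_ideal_times; rewrite mxE; apply: (hom_I hom).
  apply: alphaI; have := entries_in_ideal_times idI' lphi Ix 0 i.
  by rewrite phiT mxE.
(* The theta of the target frame absorbs the u^-1 built into [yL]. *)
have theta'E : is_theta F' (alpha theta * u^-1).
  move=> c' /(lift_I alphaI alpha_surj)[c [Ic <-]].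
  rewrite (hom_sigma hom) thetaE // (hom_sigma1 hom) // rmorphM mulrA.
  by rewrite -(mulrA (alpha theta)) mulVr ?mulr1 // (hom_unit hom).
have etaF x : wF W' (eta x) = eta (Fr x).
  have lF' := window_F_semilinear hW'.
  rewrite (proj1 lF') (semilinear_lincomb _ _ lF') (semilinear_lincomb _ _ lF').
  rewrite (proj1 leta) (proj2 leta) !(semilinear_sum _ _ _ leta) scaler_sumr.
  congr (_ + _); apply: eq_bigr => i _; rewrite mxE (hom_sigma hom) sK //=.
  rewrite (window_F_theta hF' hW' theta'E) // !scalerA; congr (_ *: _).
  by rewrite mulrA [alpha theta * _]mulrC.
have etaF1 x : Q x -> wF1 W' (eta x) = u *: eta (F1 x).
  move=> Qx; have QT : wQ W' (etaT x.2) by apply/QE'; rewrite piT_etaT -piT_eta; apply/QE'/QE.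
  have QL : wQ W' (etaL x.1).
    by apply/QE'; rewrite piT_etaL; apply: in_span0.
  rewrite (window_F1D hW') // /etaL /etaT {1}/lincomb (window_F1_sum hW');
    last by move=> i; apply: piLQ.
  rewrite {1}/lincomb (window_F1_sum_I hW');
    last by move=> i; rewrite mxE; apply: (hom_I hom).
  rewrite (proj1 leta) !(semilinear_sum _ _ _ leta) scalerDr !scaler_sumr.
  congr (_ + _); apply: eq_bigr => i _; rewrite mxE sK.
    rewrite (hom_sigma hom) !scalerA /= mulrAC divrr ?mul1r //; exact: (hom_unit hom).
  by rewrite (hom_sigma1 hom) // scalerA.
have red : @reduction _ _ alpha u W W' eta.
  split=> //; first by split=> //; split=> [x /QE|].
  by move=> y; have [x <-] := eta_surj y => /QE; exists x.
exists W, eta; split=> //; split.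
  by apply: prod_fg_projective; apply: fixmod_fg_projective.
have sQ : is_submod Q.
  split; first by move=> i; rewrite /= mxE.
  by split=> [x y Qx Qy i|c x Qx i]; rewrite /= mxE; [apply: ID | apply: IM].
split=> //; split.
  split=> [x y|c x]; rewrite /= /Fr /=.
    rewrite [RHS]addrACA -scalerDr -!big_split /=; congr (_ *: _ + _);
      by apply: eq_bigr => i _; rewrite mxE rmorphD scalerDl.
  rewrite scalerDr scalerA [sigma c * _]mulrC -scalerA !scaler_sumr; congr (_ + _).
    by apply: eq_bigr => i _; rewrite mxE rmorphM (scalerA (sigma c)).
  by apply: eq_bigr => i _; rewrite mxE rmorphM scalerA.
have F1Z c x : Q x -> F1 (c *: x) = sigma c *: F1 x.
  move=> Qx; rewrite /F1 /= scalerDr !scaler_sumr; congr (_ + _); apply: eq_bigr => i _.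
    by rewrite mxE rmorphM scalerA.
  by rewrite mxE (frame_sigma1M hF) // scalerA.
have F1D x y : Q x -> Q y -> F1 (x + y) = F1 x + F1 y.
  move=> Qx Qy; rewrite /F1 /= [RHS]addrACA; congr (_ + _);
    rewrite -big_split; apply: eq_bigr => i _.
    by rewrite mxE rmorphD scalerDl.
  by rewrite mxE (frame_sigma1D hF) // scalerDl.
do 2!split=> //; split; last split.
- apply: (normal_projection_decomposition (pi := fun x : W => (0, x.2) : W)).
  split; first by split=> *; congr (_, _); rewrite ?addr0 ?scaler0.
  split=> // x; split=> [Qx|Ix i].
    rewrite sndE; apply: (lincomb_submod (@ideal_times_submod _ _ (fI F))) => i.
    exact: mem_ideal_times.
  have l2 : S_linear (fun z : W => fixval z.2) by split.
  exact: (entries_in_ideal_times (frame_ideal hF) l2 Ix 0 i).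
- move=> c x Ic; rewrite /= /F1 /Fr /= scalerDr scalerA !scaler_sumr.
  congr (_ + _); apply: eq_bigr => i _.
    by rewrite mxE rmorphM thetaE // scalerA [theta * _]mulrC.
  by rewrite mxE mulrC (frame_sigma1M hF) // scalerA mulrC.
- set G := (G in in_span G).
  (* The values of [F1] span modulo aP because they do so in [W']; Nakayama's lemma removes the
     error. *)
  apply: (nilpotent_nakayama ker_nil (in_span_submod G)) => x.
  have [y [Gy eyx]] : exists y, in_span G y /\ eta y = eta x.
    apply: (in_span_min (K := fun y' => exists y, in_span G y /\ eta y = y')
              _ _ (window_F1_span hW' (eta x))).
      split.
        by exists 0; rewrite (semilinear0 leta); split=> //; apply: in_span0.
      split=> [_ _ [y [Gy <-]] [z [Gz <-]]|c _ [y [Gy <-]]].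
        by exists (y + z); rewrite (proj1 leta); split=> //; apply: in_spanD.
      have [d <-] := alpha_surj c.
      by exists (d *: y); rewrite (proj2 leta); split=> //; apply: in_spanZ.
    move=> _ [q' [+ ->]]; have [q <-] := eta_surj q' => /QE Qq.
    have [d du] := alpha_surj u; exists (d *: F1 q).
    rewrite (proj2 leta) du -etaF1 //; split=> //; apply: in_spanZ.
    by apply: mem_in_span; exists q.
  exists y; split=> //; apply: eta_ker.
  by rewrite (semilinearB _ _ leta) eyx subrr.
Qed.

End WindowLifting.

(** * Transfer of nilpotence between J and J', and the equivalence *)

Lemma surj_image_ideal (S S' : comUnitRingType) (alpha : {rmorphism S -> S'})
    (J : S -> Prop) :
  (forall y, exists x, alpha x = y) -> is_ideal J ->
  is_ideal (fun y => exists x, J x /\ alpha x = y).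
Proof.
move=> alpha_surj [J0 [JD JM]]; split; first by exists 0; rewrite rmorph0.
split=> [_ _ [x [Jx <-]] [y [Jy <-]]|c _ [x [Jx <-]]].
  by exists (x + y); rewrite rmorphD; split=> //; apply: JD.
by have [d <-] := alpha_surj c; exists (d * x); rewrite rmorphM; split=> //; apply: JM.
Qed.

Theorem theorem10p3 (p : nat) (S S' : comUnitRingType) (F : frame S) (F' : frame S')
  (alpha : {rmorphism S -> S'}) (u : S') (J : S -> Prop) (n : nat) (a : nat -> S -> Prop) :
  prime p -> is_frame p F -> is_frame p F' -> is_frame_hom F F' alpha u ->
  (* alpha induces an isomorphism R = S/I -> R' = S'/I' *)
  (forall x, fI F' (alpha x) -> fI F x) ->
  (forall y, exists x, fI F' (y - alpha x)) ->
  (* alpha : S -> S' is surjective *)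
  (forall y, exists x, alpha x = y) ->
  (* filtration ker alpha = a_0 >= ... >= a_n = 0 *)
  (forall i, is_ideal (a i)) ->
  (forall x, a 0%N x <-> alpha x = 0) ->
  (forall i x, (i < n)%N -> a i.+1 x -> a i x) ->
  (forall x, a n x -> x = 0) ->
  (forall i x, (i < n)%N -> a i x -> a i.+1 (fsigma F x)) ->
  (forall i x, (i <= n)%N -> a i x -> a i (fsigma1 F x)) ->
  (* f.g. projective S'-modules lift to projective S-modules *)
  (forall P' : lmodType S', fg_projective P' ->
     exists (P : lmodType S) (eta : P -> P'), projective P /\ is_mod_base_change alpha eta) ->
  is_ideal_of_definition F J ->
  (* J^m a = 0 for large m *)
  (exists m, forall (js : seq S) (x : S), size js = m -> List.Forall J js ->
       alpha x = 0 -> \prod_(j <- js) j * x = 0) ->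
  nil_crystalline F F' alpha u J (fun y => exists x, J x /\ alpha x = y).
Proof.
move=> p_prime hF hF' hom alphaI _ alpha_surj _ _ _ _ _ _ _ [idJ [sigmaJ [IJ _]]] [m J_ker].
have p_gt0 := prime_gt0 p_prime.
set J' := (J' in nil_crystalline _ _ _ _ _ J').
have idJ' : is_ideal J' := surj_image_ideal alpha_surj idJ.
have kerJ x : alpha x = 0 -> J x by move=> x0; apply/IJ/(ker_I hF' alphaI x0).
(* [J] contains the kernel, so it is the full preimage of [J']. *)
have JJ' x : J' (alpha x) -> J x.
  case=> y [Jy eq_yx]; have [_ [JD _]] := idJ; rewrite -(subrK y x).
  by apply: JD => //; apply: kerJ; rewrite rmorphB eq_yx subrr.
(* One factor is used as the element of the kernel and the other [m] as elements of [J]. *)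
have ker_nil js : size js = m.+1 -> List.Forall (fun x => alpha x = 0) js ->
    \prod_(j <- js) j = 0.
  case: js => [|x js] //= [szjs] kjs; inversion_clear kjs as [|? ? x0 kjs'].
  rewrite big_cons mulrC; apply: J_ker => //.
  by elim: kjs' => [|y js' y0 _ IH]; constructor => //; apply: kerJ.
split; [|split].
- move=> W W' eta hW nilW bc; have hW' := proj1 bc.
  have red := base_change_reduction hF' hom alphaI alpha_surj hW bc.
  have [r [e [phi db]]] := fg_projective_dual_basis (window_fg_projective hW).
  have [C [k [vC Jk]]] := nilpotent_window_twisted_power hW idJ nilW db.
  have [phi' vC'] := reduction_verschiebung hom alpha_surj red vC.
  apply: (twisted_power_nilpotent_window (n := k) idJ' vC').
  have [c [_ ->]] := twisted_power_reduction hom C k.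
  move=> i j; rewrite !mxE; have [_ [_ JM']] := idJ'; apply: JM'.
  by eexists; split; first exact: (Jk i j).
- move=> W1 W2 W2' eta2 hW1 nilW1 hW2 _ bc.
  have red := base_change_reduction hF' hom alphaI alpha_surj hW2 bc.
  have [r [e [phi db]]] := fg_projective_dual_basis (window_fg_projective hW1).
  have [C [k [vC Jk]]] := nilpotent_window_twisted_power hW1 idJ nilW1 db.
  split=> [g ghom|f f' hf hf'].
    exact: (reduction_full p_gt0 hF hF' hom alphaI sigmaJ J_ker hW1 hW2 vC Jk red ghom).
  exact: (reduction_faithful hF' hom alphaI sigmaJ J_ker hW1 hW2 vC Jk red hf hf').
- move=> W' hW' nilW'.
  have [W [eta [hW red]]] :=
    reduction_lift hF hF' hom alphaI alpha_surj (ltn0Sn m) ker_nil hW'.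
  exists W, eta; split=> //; split; last exact: reduction_base_change.
  have [r [e [phi db]]] := fg_projective_dual_basis (window_fg_projective hW).
  have [C vC] := verschiebung_matrix_exists hW p_gt0 hF db.
  have [phi' vC'] := reduction_verschiebung hom alpha_surj red vC.
  have [r1 [e1 [phi1 db1]]] := fg_projective_dual_basis (window_fg_projective hW').
  have [C1 [k [vC1 Jk]]] := nilpotent_window_twisted_power hW' idJ' nilW' db1.
  (* The extra power pays for passing from the dual basis [e1] to the reduced one [eta \o e]. *)
  apply: (twisted_power_nilpotent_window (n := k.+1) idJ vC) => i j; apply: JJ'.
  have := twisted_power_ideal_change hW' idJ' vC' vC1 Jk i j.
  have [c [uc ->]] := twisted_power_reduction hom C k.+1.
  rewrite 2!mxE => Jc; rewrite -[alpha _]mul1r -(mulVr uc) -mulrA.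
  by have [_ [_]] := idJ'; apply.
Qed.
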